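(* Let $n\ge 1$ and $d\ge 1$ be integers. If $f$ is generic in $\mathbb{R}[x]_{=d}$, then Lasserre's hierarchy for the problem $\min\{f(x): x\in\mathbb{S}^{n-1}\}$ has finite convergence.
   Context: $\mathbb{R}[x]$ is the ring of real polynomials in $x=(x_1,\dots,x_n)$, and $\mathbb{R}[x]_{=d}$ is the real vector space of all homogeneous polynomials of degree $d$ (including $0$), identified with the space of coefficient vectors. $\mathbb{S}^{n-1}=\{x\in\mathbb{R}^n: x_1^2+\cdots+x_n^2=1\}$. A property holds ''if $f$ is generic in $\mathbb{R}[x]_{=d}$'' if it holds for all $f\in\mathbb{R}[x]_{=d}$ outside a set of Lebesgue measure zero in $\mathbb{R}[x]_{=d}$. Lasserre's hierarchy: let $f_{\min}:=\min\{f(x):x\in\mathbb{S}^{n-1}\}$. For each integer $k$ with $2k\ge\max\{d,2\}$, the $k$-th order relaxation value is $$f_k:=\sup\Big\{\gamma\in\mathbb{R}:\ f-\gamma=\sigma+h\cdot(x_1^2+\cdots+x_n^2-1)\Big\},$$ where $\sigma$ ranges over sums of squares of polynomials in $\mathbb{R}[x]$ with $\deg\sigma\le 2k$, and $h$ ranges over polynomials in $\mathbb{R}[x]$ with $\deg h\le 2k-2$. One has $f_k\le f_{k+1}\le f_{\min}$. The hierarchy has finite convergence if $f_k=f_{\min}$ for some $k$ (hence for all larger $k$). *)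

(* Defs.v *)
(* MathComp-Analysis + multinomials.  The notations of mpoly clash with those of
   MathComp-Analysis, so mpoly is imported without them. *)
From HB Require Import structures.
From mathcomp Require Import all_boot all_order all_algebra.
From mathcomp Require mpoly.
Import -(notations) mpoly.
From mathcomp Require Import all_classical all_reals all_analysis.

Set Implicit Arguments.
Unset Strict Implicit.
Unset Printing Implicit Defensive.

Import Order.TTheory GRing.Theory Num.Theory.
Local Open Scope classical_set_scope.
Local Open Scope ring_scope.

Local Notation "{ 'mpoly' R [ n ] }" := (mpoly n R).
Local Notation "''X_' i" := (mpolyX _ (mnm1 i)).
Local Notation msize p := (mmeasure mdeg p).

Section LebesgueTuple.
Variable R : realType.

Definition tuple_cons (N : nat)
    (p : measurableTypeR R * N.-tuple (measurableTypeR R)) :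
    N.+1.-tuple (measurableTypeR R) := [tuple of p.1 :: p.2].

(* The library has Lebesgue measure on R only; on R^N we take the N-fold product
   measure, transported along R * R^N ~ R^(N+1). *)
Fixpoint lebesgue_tuple (N : nat) :
    set (N.-tuple (measurableTypeR R)) -> \bar R :=
  match N with
  | 0 => \d_[tuple]
  | N'.+1 => pushforward (@lebesgue_measure R \x @lebesgue_tuple N')%E
                         (@tuple_cons N')
  end.

Lemma measurable_tuple_cons N : measurable_fun setT (@tuple_cons N).
Proof. exact: measurable_cons. Qed.

Lemma tuple_cons_box N (A : 'I_N.+1 -> set (measurableTypeR R)) :
  @tuple_cons N @^-1` [set t | forall i, A i (tnth t i)] =
  A ord0 `*` [set t | forall i, A (lift ord0 i) (tnth t i)].
Proof.
apply/seteqP; split => [[x t] /= H|[x t] /= [H0 H] i].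
  split => [|i /=]; first by have := H ord0; rewrite tnth0.
  by have := H (lift ord0 i); rewrite tnthS.
by case: (unliftP ord0 i) => [j|] ->; rewrite ?tnth0 ?tnthS.
Qed.

Lemma measurable_tuple_uncons N : measurable_fun setT
  (fun t : N.+1.-tuple (measurableTypeR R) =>
     (thead t, [tuple of behead t]) : measurableTypeR R * N.-tuple _).
Proof.
apply/measurable_fun_pairP; split => /=.
  exact: measurable_tnth.
exact: measurable_behead.
Qed.

Section Step.
Variables (N : nat)
  (mu : {sigma_finite_measure set (N.-tuple (measurableTypeR R)) -> \bar R}).

Let nu := pushforward (@lebesgue_measure R \x mu)%E (@tuple_cons N).

Let mcons := @measurable_tuple_cons N.

Let nu0 : nu set0 = 0%E.
Proof. exact: measure0. Qed.

Let nu_ge0 A : (0 <= nu A)%E.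
Proof. exact: measure_ge0. Qed.

Let nu_sigma_additive : semi_sigma_additive nu.
Proof. exact: measure_semi_sigma_additive. Qed.

HB.instance Definition _ :=
  isMeasure.Build _ _ _ nu nu0 nu_ge0 nu_sigma_additive.

Let nu_sigma_finite : sigma_finite setT nu.
Proof.
have /sigma_finiteP[F [TF ndF Foo]] := sigma_finiteT (@lebesgue_measure R).
have /sigma_finiteP[G [TG ndG Goo]] := sigma_finiteT mu.
pose unc (t : N.+1.-tuple (measurableTypeR R)) :
  measurableTypeR R * N.-tuple _ := (thead t, [tuple of behead t]).
have uncK : cancel (@tuple_cons N) unc.
  by case=> x t; congr pair; apply/val_inj.
exists (fun i => unc @^-1` (F i `*` G i)).
  apply/seteqP; split => // t _.
  have [k _ Fk] : (\bigcup_k F k) (unc t).1 by rewrite -TF.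
  have [l _ Gl] : (\bigcup_l G l) (unc t).2 by rewrite -TG.
  exists (maxn k l) => //; split.
    by move: Fk; exact/subsetPset/ndF/leq_maxl.
  by move: Gl; exact/subsetPset/ndG/leq_maxr.
move=> i; have [mFi Fioo] := Foo i; have [mGi Gioo] := Goo i; split.
  rewrite -[X in measurable X]setTI; apply: measurable_tuple_uncons => //.
  exact: measurableX.
rewrite /nu /pushforward -comp_preimage.
rewrite (_ : unc \o _ = id) ?preimage_id; last by apply/funext => p; exact: uncK.
by rewrite product_measure1E // lte_mul_pinfty // ge0_fin_numE.
Qed.

HB.instance Definition _ :=
  Measure_isSigmaFinite.Build _ _ _ nu nu_sigma_finite.

Definition lebesgue_tuple_step :
  {sigma_finite_measure set (N.+1.-tuple (measurableTypeR R)) -> \bar R} := nu.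

End Step.

Lemma lebesgue_tuple_measure N :
  {mu : {sigma_finite_measure set (N.-tuple (measurableTypeR R)) -> \bar R} |
    mu = @lebesgue_tuple N :> (set _ -> \bar R)}.
Proof.
elim: N => [|N [mu muE]]; first by exists \d_[tuple].
by exists (lebesgue_tuple_step mu); rewrite /= -muE.
Qed.

Let lebesgue_tuple0 N : @lebesgue_tuple N set0 = 0%E.
Proof. by have [mu <-] := lebesgue_tuple_measure N; exact: measure0. Qed.

Let lebesgue_tuple_ge0 N A : (0 <= @lebesgue_tuple N A)%E.
Proof. by have [mu <-] := lebesgue_tuple_measure N; exact: measure_ge0. Qed.

Let lebesgue_tuple_sigma_additive N : semi_sigma_additive (@lebesgue_tuple N).
Proof.
have [mu <-] := lebesgue_tuple_measure N; exact: measure_semi_sigma_additive.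
Qed.

HB.instance Definition _ N := isMeasure.Build _ _ _ (@lebesgue_tuple N)
  (lebesgue_tuple0 N) (@lebesgue_tuple_ge0 N) (@lebesgue_tuple_sigma_additive N).

Let lebesgue_tuple_sigma_finite N : sigma_finite setT (@lebesgue_tuple N).
Proof. by have [mu <-] := lebesgue_tuple_measure N; exact: sigma_finiteT. Qed.

HB.instance Definition _ N :=
  Measure_isSigmaFinite.Build _ _ _ (@lebesgue_tuple N)
    (@lebesgue_tuple_sigma_finite N).

Lemma measurable_box N (A : 'I_N -> set (measurableTypeR R)) :
  (forall i, measurable (A i)) ->
  measurable ([set t : N.-tuple (measurableTypeR R) |
                 forall i, A i (tnth t i)]).
Proof.
elim: N A => [|N IH] A mA.
  rewrite (_ : [set _ | _] = setT) //.
  by apply/seteqP; split => // t _ [].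
pose unc (t : N.+1.-tuple (measurableTypeR R)) :
  measurableTypeR R * N.-tuple _ := (thead t, [tuple of behead t]).
pose B := A ord0 `*` [set t : N.-tuple _ | forall i, A (lift ord0 i) (tnth t i)].
have -> : [set t | forall i, A i (tnth t i)] = unc @^-1` B.
  rewrite /B -tuple_cons_box -comp_preimage.
  by rewrite (_ : _ \o _ = id)//; apply/funext => t; rewrite /tuple_cons /= -tuple_eta.
have mB : measurable B.
  by apply: measurableX => //; apply: (IH (fun i => A (lift ord0 i))).
by rewrite -[X in measurable X]setTI; apply: measurable_tuple_uncons.
Qed.

(* [lebesgue_tuple] is the Lebesgue measure: it has the right value on boxes. *)
Lemma lebesgue_tuple_box N (A : 'I_N -> set (measurableTypeR R)) :
  (forall i, measurable (A i)) ->
  lebesgue_tuple [set t | forall i, A i (tnth t i)] =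
  (\prod_(i < N) lebesgue_measure (A i))%E.
Proof.
elim: N A => [|N IH] A mA.
  by rewrite big_ord0 /= diracE mem_set // => -[].
rewrite big_ord_recl /= /pushforward tuple_cons_box product_measure1E //.
  by congr (_ * _)%E; apply: (IH (fun i => A (lift ord0 i))).
exact: (@measurable_box _ (fun i => A (lift ord0 i))).
Qed.

End LebesgueTuple.

Section Homogeneous.
Variables (R : realType) (n d : nat).

(* Exponents of the monomials of degree exactly d; the bound d.+1 only serves to
   make the type finite. *)
Definition monom_of_deg := {m : bmultinom n d.+1 | mdeg m == d}.

Definition coeff_vector (f : dhomog n R d) :
    #|{: monom_of_deg}|.-tuple (measurableTypeR R) :=
  [tuple mcoeff (val (enum_val i)) f | i < #|{: monom_of_deg}|].

Definition generic (P : dhomog n R d -> Prop) : Prop :=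
  (@lebesgue_tuple R _).-negligible (coeff_vector @` [set f | ~ P f]).

End Homogeneous.

Section Lasserre.
Variables (R : realType) (n : nat).

Definition sphere : set ('I_n -> R) := [set x | \sum_i x i ^+ 2 = 1].

Definition sphere_poly : {mpoly R[n]} := \sum_i 'X_i ^+ 2 - 1.

Definition is_sos (p : {mpoly R[n]}) : Prop :=
  exists qs : seq {mpoly R[n]}, p = \sum_(q <- qs) q ^+ 2.

(* [msize p] is deg p + 1, and 0 for p = 0; so [msize p <= e.+1] is deg p <= e. *)
Definition lasserre_feasible (f : {mpoly R[n]}) (k : nat) : set R :=
  [set gamma | exists sigma h : {mpoly R[n]},
    [/\ is_sos sigma,
        (msize sigma <= (2 * k).+1)%N,
        (msize h <= (2 * k - 2).+1)%N &
        f - mpolyC n gamma = sigma + h * sphere_poly]].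

(* The supremum is taken in the extended reals, hence -oo if no gamma is
   feasible. *)
Definition lasserre_value (f : {mpoly R[n]}) (k : nat) : \bar R :=
  ereal_sup [set gamma%:E | gamma in lasserre_feasible f k].

Definition is_sphere_min (f : {mpoly R[n]}) (m : R) : Prop :=
  let values := [set meval x f | x in sphere] in values m /\ lbound values m.

Definition lasserre_finite_convergence (d : nat) (f : {mpoly R[n]}) : Prop :=
  exists k : nat, (maxn d 2 <= 2 * k)%N /\
    exists2 fmin : R, is_sphere_min f fmin & lasserre_value f k = fmin%:E.

End Lasserre.

(* Main.v *)
Require Import Defs.
From HB Require Import structures.
From mathcomp Require Import all_boot all_order all_algebra.
From mathcomp Require mpoly.
Import -(notations) mpoly.
From mathcomp Require Import all_classical all_reals all_analysis.
From mathcomp Require Import zify ring lra.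

(* The minimum over the sphere of the form with coefficient vector [u] is a concave
   function of [u].  A concave function of one variable satisfies
   F(u + s) + F(u - s) - 2 F(u) >= - K s^2 for some K and all small s, at almost
   every u; by Fubini this holds almost everywhere along all coordinate axes at
   once, and concavity extends it to all directions.  At such an [f], for a
   minimizer p, testing F on the perturbations of [f] by multiples of
   p^m - y^m for each monomial m gives
   f(y) - f(p) >= kappa (1 - (p.y)^d) on the sphere, so that p is the unique
   minimizer (up to sign if d is even) and the Hessian at p is positive definite.

   Expanding [f] at p, f - f(p) is congruent modulo the sphere to a sum of squares
   l_k^2 with polynomial weights s_k, where the l_k vanish at the minimizers only
   and the s_k are positive there.  With L the sum of the l_k^2 and c > 0 small,
   replacing s_k by s_k (1 - c L)^m + (f - f(p)) (1 - (1 - c L)^m) / L preserves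
   the sum and, for m large, makes all weights positive on the sphere, hence sums
   of squares by the Positivstellensatz for archimedean preorderings. *)

Set Implicit Arguments.
Unset Strict Implicit.
Unset Printing Implicit Defensive.
Import Order.TTheory GRing.Theory Num.Theory.
Import numFieldNormedType.Exports.
Local Open Scope classical_set_scope.
Local Open Scope ring_scope.

Local Notation "{ 'mpoly' R [ n ] }" := (mpoly n R).
Local Notation "''X_' i" := (mpolyX _ (mnm1 i)).

(** * Second differences of convex functions *)

(** The growth bound comes from monomial vectors. The minimum over the sphere is a minimum of linear
    functions of [u], whose gradients are the vectors of monomials at the points of the sphere. If y
    were nearly minimal while its monomial vector was far from that of p, a slight tilt of [u]
    towards y would make the minimum drop by more than the bound on second differences allows. The
    squared distance of the two vectors dominates 1 - (p.y)^d up to a constant, because the entries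
    of the d-th tensor powers of p and y are monomials.

    The detour through weights is forced: f - f(p) has zeros on the sphere, where the
    Positivstellensatz asks for strict positivity. The constant kappa makes the Hessian larger than
    nonnegativity requires; this surplus is spread over the squares, so that every weight is
    positive at the minimizers.

    The degrees in the certificate are not controlled, since the order of the relaxation can be
    taken as large as the certificate requires. *)

Section ConvexLine.
Variables (R : realType) (g : R -> R).

Definition slope (x y : R) : R := (g y - g x) / (y - x).

Hypothesis g_convex : forall x y z w, x < y -> y <= z -> z < w ->
  slope x y <= slope z w.
Hypothesis g_lipschitz : forall x y, x < y -> -1 <= slope x y <= 1.

Definition second_diff (t s : R) : R := g (t + s) + g (t - s) - 2 * g t.

Lemma second_diff_slope t s : 0 < s ->
  second_diff t s / s = slope t (t + s) - slope (t - s) t.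
Proof.
move=> s0; rewrite /second_diff /slope.
have -> : t + s - t = s by ring.
have -> : t - (t - s) = s by ring.
by field; rewrite gt_eqF.
Qed.

(* Slopes of disjoint intervals, taken from left to right, form a chain, so the
   sum telescopes. *)
Lemma sum_second_diff (D : seq (R * {posnum R})) z w : uniq D ->
  trivIset [set` D] (fun i => ball i.1 i.2%:num) ->
  (forall i, i \in D -> i.1 + i.2%:num <= z) -> z < w ->
  \sum_(i <- D) second_diff i.1 i.2%:num / i.2%:num <= 1 + slope z w.
Proof.
pose le (i j : R * {posnum R}) := j.1 <= i.1.
wlog : D / sorted le D.
  move=> H uD tD Dz zw.
  have pD : perm_eq (sort le D) D by rewrite perm_sort.
  rewrite -(perm_big _ pD)/=; apply: H => //.
  - by apply: sort_sorted => x y; exact: le_total.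
  - by rewrite (perm_uniq pD).
  - by rewrite (_ : [set` sort le D] = [set` D])//; apply/seteqP;
      split=> i /=; rewrite mem_sort.
  - by move=> i; rewrite mem_sort; exact: Dz.
elim: D z w => [|i D IH] z w sD uD tD Dz zw.
  by rewrite big_nil; have := g_lipschitz zw; lra.
rewrite big_cons.
have le_tr : transitive le by move=> a b c ab bc; exact: le_trans bc ab.
have leD := order_path_min le_tr sD.
have i0 : 0 < i.2%:num by [].
rewrite second_diff_slope//.
have /= /andP[iD uD'] := uD.
(* The head has the rightmost centre, so the other balls lie to its left and the induction
   hypothesis applies with the left half of its ball in place of [z, w]. *)
have tl : \sum_(j <- D) second_diff j.1 j.2%:num / j.2%:num
    <= 1 + slope (i.1 - i.2%:num) i.1.
  apply: IH => //.
  - exact: path_sorted sD.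
  - by apply: sub_trivIset tD => j /= jD; rewrite inE jD orbT.
  - move=> j jD.
    have ji : j != i by apply: contraNneq iD => <-.
    have lji : j.1 <= i.1 by exact: (allP leD).
    rewrite leNgt; apply/negP => Hlt.
    have j0 : 0 < j.2%:num by [].
    suff : i = j by move=> /esym/eqP; exact/negP.
    apply: tD => /=; rewrite ?inE ?eqxx ?jD ?orbT//.
    (* Overlapping balls would share one of the two centres or the midpoint of the overlap. *)
    have [h1|h1] := ltP i.1 (j.1 + j.2%:num).
      by exists i.1; split; rewrite /ball/= ltr_norml; lra.
    have [h2|h2] := ltP (i.1 - i.2%:num) j.1.
      by exists j.1; split; rewrite /ball/= ltr_norml; lra.
    exists ((i.1 - i.2%:num + (j.1 + j.2%:num)) / 2).
    by split; rewrite /ball/= ltr_norml; lra.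
  - lra.
have : slope i.1 (i.1 + i.2%:num) <= slope z w.
  by apply: g_convex => //; [lra|apply: Dz; rewrite mem_head].
lra.
Qed.

Definition bad_points (K : R) : set R :=
  [set t | exists s, [/\ 0 < s, s <= 1 & K * s ^+ 2 < second_diff t s]].


Lemma bad_points_nbhs K t : bad_points K t ->
  exists2 e, 0 < e & forall u, `|u - t| < e -> bad_points K u.
Proof.
have gl x y : `|g x - g y| <= `|x - y|.
  have aux a b : a < b -> `|g b - g a| <= `|b - a|.
    move=> ab; have ba : 0 < b - a by rewrite subr_gt0.
    have := g_lipschitz ab.
    rewrite /slope ler_pdivrMr// ler_pdivlMr// mulN1r mul1r => H.
    by rewrite (gtr0_norm ba) ler_norml.
  by have [xy|xy|->] := ltgtP x y; [rewrite distrC (distrC x); exact: aux|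
    exact: aux|rewrite !subrr].
move=> [s [s0 s1 H]].
(* For fixed [s], [second_diff t s] is 4-Lipschitz in [t]. *)
exists ((second_diff t s - K * s ^+ 2) / 4); first by rewrite divr_gt0// subr_gt0.
move=> u ut; exists s; split => //; move: ut H; rewrite /second_diff.
have := gl (u + s) (t + s); have := gl (u - s) (t - s); have := gl u t.
have -> : u + s - (t + s) = u - t by ring.
have -> : u - s - (t - s) = u - t by ring.
rewrite !ler_norml; lra.
Qed.

Lemma bad_points_open K : open (bad_points K).
Proof.
rewrite openE => t /bad_points_nbhs[e e0 H].
apply/nbhs_ballP; exists e => // u; rewrite /ball/= distrC; exact: H.
Qed.

(** A compact subset is covered by finitely many balls with K s < second_diff t s / s, where t is
    the centre and s the radius; by Vitali, disjoint ones among them cover it once tripled. Slopes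
    lie in [-1, 1], so the right-hand sides sum to at most 2 and the radii to at most 2 / K; a
    tripled ball has length 6 s, whence 12 / K. *)
Lemma measure_bad_points K : 0 < K ->
  (lebesgue_measure (bad_points K) <= (12 / K)%:E)%E.
Proof.
move=> K0.
rewrite lebesgue_regularity_inner_sup; last first.
  by apply: measurable_realfun.open_measurable; exact: bad_points_open.
apply: ge_ereal_sup => _ [C [cC CB] <-].
pose B (i : R * {posnum R}) := ball i.1 i.2%:num.
pose D := [set i : R * {posnum R} | i.2%:num <= 1 /\
  K * i.2%:num ^+ 2 < second_diff i.1 i.2%:num].
have [D' D'D CD'] : finite_subset_cover D B C.
  move: cC; rewrite compact_cover; apply.
    by move=> i _; exact: ball_open.
  move=> t /CB[s [s0 s1 H]]; exists (t, PosNum s0); first by split.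
  exact: ballxx.
have [|E [uE ED' tE cE]] := vitali_lemma_finite_cover
    (fun i : R * {posnum R} => is_ball_ball i.1 i.2%:num) _ (finmap.enum_fset D').
  by move=> i; exists i.1; exact: ballxx.
have sumE : \sum_(i <- E) (3 * i.2%:num) *+ 2 <= 12 / K.
  have Es i : i \in E -> K * i.2%:num <= second_diff i.1 i.2%:num / i.2%:num.
    move=> /ED'/D'D; rewrite inE => -[_ H].
    by rewrite ler_pdivlMr// -mulrA -expr2 ltW.
  have [z zE] : exists z, forall i, i \in E -> i.1 + i.2%:num <= z.
    elim: (E) => [|i F [z zF]]; first by exists 0.
    exists (Num.max (i.1 + i.2%:num) z) => j; rewrite inE le_max.
    by move=> /predU1P[->|/zF ->]; rewrite ?lexx ?orbT.
  have z1 : z < z + 1 by rewrite ltrDl.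
  have h2 := sum_second_diff uE tE zE z1; have /andP[_ h1] := g_lipschitz z1.
  have : \sum_(i <- E) K * i.2%:num <= 2.
    apply: (@le_trans _ _ (\sum_(i <- E) second_diff i.1 i.2%:num / i.2%:num)).
      by rewrite !big_seq; exact: ler_sum.
    by rewrite (le_trans h2)//; lra.
  rewrite ler_pdivlMr// -mulr_sumr => h.
  have -> : \sum_(i <- E) (3 * i.2%:num) *+ 2 = 6 * \sum_(i <- E) i.2%:num.
    by rewrite mulr_sumr; apply: eq_bigr => i _; rewrite -mulr_natr; ring.
  lra.
apply: (@le_trans _ _ (\sum_(i <- E) (3 * i.2%:num) *+ 2)%:E); last first.
  by rewrite lee_fin.
have CU : C `<=` \big[setU/set0]_(i <- E) ball i.1 (3 * i.2%:num).
  move=> t /CD'/cE [i iE]; rewrite /comp scale_ballE// => h.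
  by rewrite -bigcup_seq; exists i.
have mb (F : seq (R * {posnum R})) : measurable (\big[setU/set0]_(i <- F)
    (ball i.1 (3 * i.2%:num) : set (measurableTypeR R))).
  apply: bigsetU_measurable => i _.
  exact: measurable_realfun.measurable_ball.
apply: (@le_trans _ _ (lebesgue_measure (\big[setU/set0]_(i <- E)
    (ball i.1 (3 * i.2%:num) : set (measurableTypeR R))))).
  apply: le_measure => //; rewrite inE//.
  exact: measurable_realfun.compact_measurable.
elim: (E) => [|i F IH]; first by rewrite !big_nil measure0.
rewrite !big_cons EFinD (le_trans (measureU2 _ _ _))//.
  exact: measurable_realfun.measurable_ball.
apply: leeD => //. by rewrite -(lebesgue_measure_ball i.1) ?mulr_ge0.
Qed.

End ConvexLine.

(** * Null sets by slices, and second differences almost everywhere *)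

Section NullSlices.
Variable R : realType.
Local Notation mR := (measurableTypeR R).

Definition set_coord N (a : N.-tuple mR) (i : 'I_N) (t : mR) : N.-tuple mR :=
  [tuple if j == i then t else tnth a j | j < N].

Lemma tnth_set_coord N (a : N.-tuple mR) i t j :
  tnth (set_coord a i t) j = if j == i then t else tnth a j.
Proof. by rewrite tnth_mktuple. Qed.

Lemma measurable_tuple_cons_preimage N (B : set (N.+1.-tuple mR)) :
  measurable B -> measurable (@tuple_cons R N @^-1` B).
Proof.
by move=> mB; rewrite -[X in measurable X]setTI; exact: measurable_tuple_cons.
Qed.

(** Tonelli's theorem in the coordinate [i]. The measure peels off the first coordinate, so later
    coordinates go by induction on sections; for [ord0] the order of integration is exchanged by
    uniqueness of the product measure. *)
Lemma null_slices N (i : 'I_N) (B : set (N.-tuple mR)) : measurable B ->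
  (forall a, lebesgue_measure [set t | B (set_coord a i t)] = 0) ->
  lebesgue_tuple B = 0%E.
Proof.
elim: N i B => [[]//|N IH i B mB B0].
have mB' := measurable_tuple_cons_preimage mB.
rewrite /= /pushforward.
case: (unliftP ord0 i) B0 => [j|] -> B0.
- rewrite [LHS]integral0_eq// => x _ /=.
  apply: (IH j); first exact: measurable_xsection.
  move=> a; rewrite -(B0 (tuple_cons (x, a))); congr (lebesgue_measure _).
  apply/seteqP; split => t /=; rewrite /xsection /= ?inE/=;
  rewrite (_ : tuple_cons (x, set_coord a j t) =
    set_coord (tuple_cons (x, a)) (lift ord0 j) t)//;
  apply: eq_from_tnth => k; rewrite tnth_set_coord;
  case: (unliftP ord0 k) => [l|] ->; rewrite ?tnthS ?tnth0 ?(inj_eq lift_inj)//;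
  by rewrite tnth_set_coord.
- rewrite (@product_measure_unique _ _ _ _ _ (@lebesgue_measure R)
    (@lebesgue_tuple R N) (@lebesgue_measure R \x^ @lebesgue_tuple R N)%E)//; last first.
    by move=> *; exact: product_measure2E.
  rewrite [LHS]integral0_eq// => y _ /=.
  rewrite -(B0 (tuple_cons (0, y))); congr (lebesgue_measure _).
  apply/seteqP; split => t /=; rewrite /ysection /= ?inE/=;
  rewrite (_ : tuple_cons (t, y) = set_coord (tuple_cons (0, y)) ord0 t)//;
  apply: eq_from_tnth => k; rewrite tnth_set_coord;
  by case: (unliftP ord0 k) => [l|] ->; rewrite ?tnthS ?tnth0.
Qed.

(* Such a set is the union of the rational boxes it contains. *)
Lemma measurable_box_open N (U : set (N.-tuple mR)) :
  (forall a, U a -> exists2 e, 0 < e &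
     forall b, (forall i, `|tnth b i - tnth a i| < e) -> U b) ->
  measurable U.
Proof.
move=> oU.
pose box (q : N.-tuple rat) (k : nat) : set (N.-tuple mR) :=
  [set t | forall i, ball (ratr (tnth q i) : R) k.+1%:R^-1 (tnth t i)].
have -> : U = \bigcup_(qk in [set qk | box qk.1 qk.2 `<=` U]) box qk.1 qk.2.
  apply/seteqP; split => [a /oU[e e0 aU]|a [qk /= + ]]; last exact.
  have e20 : 0 < e / 2 by rewrite divr_gt0.
  have [k ke] : exists k : nat, k.+1%:R^-1 < e / 2.
    exists (Num.truncn (e / 2)^-1).
    by rewrite invf_plt ?posrE// truncnS_gt// invr_ge0 ltW.
  have k0 : (0 : R) < k.+1%:R^-1 by rewrite invr_gt0.
  have /all_sig[q qa] : forall i, {q : rat | ball (ratr q : R) k.+1%:R^-1 (tnth a i)}.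
    move=> i; apply: cid.
    have [|q] := @rat_in_itvoo R (tnth a i - k.+1%:R^-1) (tnth a i + k.+1%:R^-1).
      by rewrite ltrD2l (lt_trans _ k0)// oppr_lt0.
    rewrite in_itv/= => /andP[h1 h2]; exists q.
    move: h1 h2; move: (k.+1%:R^-1) => r h1 h2.
    by rewrite /ball/= ltr_norml; apply/andP; split; lra.
  exists ([tuple q i | i < N], k) => /=; last by move=> i; rewrite tnth_mktuple.
  move=> b /= hb; apply: aU => i.
  have := hb i; have := qa i; rewrite tnth_mktuple /ball/= !ltr_norml.
  move: ke; move: (k.+1%:R^-1) => r ke /andP[? ?] /andP[? ?].
  by apply/andP; split; lra.
rewrite bigcup_mkcond; apply: countable_bigcupT_measurable => [|[q k]].
  exact: countableP.
case: ifP => // _.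
rewrite /box /=.
have := @measurable_box R N (fun i => ball (ratr (tnth q i) : R) k.+1%:R^-1).
apply => i.
exact: measurable_realfun.measurable_ball.
Qed.

Lemma set_coordK N (a : N.-tuple mR) i t u :
  set_coord (set_coord a i t) i u = set_coord a i u.
Proof.
by apply: eq_from_tnth => j; rewrite !tnth_set_coord; case: eqP.
Qed.

Definition add_coord N (a : N.-tuple mR) (i : 'I_N) (s : R) :=
  set_coord a i (tnth a i + s).

Lemma set_coord_id N (a : N.-tuple mR) i : set_coord a i (tnth a i) = a.
Proof. by apply: eq_from_tnth => j; rewrite tnth_set_coord; case: eqP => // ->. Qed.

Section AeSecondDiff.
Variables (N : nat) (G : N.-tuple mR -> R).
Hypothesis G_convex : forall a i x y z w, x < y -> y <= z -> z < w ->
  slope (fun t => G (set_coord a i t)) x y <=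
  slope (fun t => G (set_coord a i t)) z w.
Hypothesis G_lipschitz : forall a b,
  `|G a - G b| <= \sum_i `|tnth a i - tnth b i|.

Let line a i (t : R) := G (set_coord a i t).

Let line_lipschitz a i x y : x < y -> -1 <= slope (line a i) x y <= 1.
Proof.
move=> xy; have yx : 0 < y - x by rewrite subr_gt0.
rewrite /slope ler_pdivlMr// ler_pdivrMr// mulN1r mul1r -ler_norml.
apply: (le_trans (G_lipschitz _ _)).
rewrite (bigD1 i)//= !tnth_set_coord eqxx gtr0_norm// big1 ?addr0// => j ji.
by rewrite !tnth_set_coord (negbTE ji) subrr normr0.
Qed.

Let bad i K : set (N.-tuple mR) := [set a | bad_points (line a i) K (tnth a i)].

Let second_diff_line a i s : second_diff (line a i) (tnth a i) s =
  G (add_coord a i s) + G (add_coord a i (- s)) - 2 * G a.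
Proof. by rewrite /second_diff /line set_coord_id. Qed.

Let measurable_bad i K : measurable (bad i K).
Proof.
apply: measurable_box_open => a [s [s0 s1]]; rewrite second_diff_line => H.
set A := G _ + _ - _ in H.
have N0 : 0 <= N%:R :> R by [].
(* A move by less than [e] in every coordinate changes each value of [G] by at most N e, hence [A]
   by at most 4 N e; the remaining [e] keeps the inequality strict. *)
pose e := (A - K * s ^+ 2) / (4 * N%:R + 1).
have N1 : 0 < 4 * N%:R + 1 :> R by rewrite ltr_wpDl// mulr_ge0.
have e0 : 0 < e by rewrite divr_gt0// subr_gt0.
exists e => // b ba; exists s; split => //; rewrite second_diff_line.
have shift r : `|G (add_coord a i r) - G (add_coord b i r)| <= N%:R * e.
  apply: (le_trans (G_lipschitz _ _)).
  rewrite -[N in X in _ <= X](card_ord N) mulr_natl -sumr_const.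
  apply: ler_sum => j _; rewrite !tnth_set_coord distrC ltW//.
  case: eqP => _; last exact: ba.
  by rewrite (_ : _ - _ = tnth b i - tnth a i)//; ring.
have noshift : `|G a - G b| <= N%:R * e.
  apply: (le_trans (G_lipschitz _ _)).
  rewrite -[N in X in _ <= X](card_ord N) mulr_natl -sumr_const.
  by apply: ler_sum => j _; rewrite distrC ltW.
have E : 4 * (N%:R * e) + e = A - K * s ^+ 2.
  have <- : e * (4 * N%:R + 1) = A - K * s ^+ 2 by rewrite /e divfK// gt_eqF.
  by ring.
have := shift s; have := shift (- s); move: noshift.
by rewrite !ler_norml; move: E e0; rewrite /A; lra.
Qed.

(** The exceptional set consists of the points that, along some axis, are bad for every K. Its
    slices along that axis have measure at most 12 / K for every K, hence are null. *)
Lemma ae_second_diff : exists B, [/\ measurable B, lebesgue_tuple B = 0%E &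
  forall a, ~ B a -> exists2 K, 0 < K & forall i s, 0 < s -> s <= 1 ->
    G (add_coord a i s) + G (add_coord a i (- s)) - 2 * G a <= K * s ^+ 2].
Proof.
pose B i := \bigcap_(k in @setT nat) bad i k.+1%:R.
have mB i : measurable (B i) by apply: bigcap_measurable => // k _.
have B0 i : lebesgue_tuple (B i) = 0%E.
  apply: (null_slices (i := i)) => // a.
  have slice k : [set t | bad i k.+1%:R (set_coord a i t)] =
      bad_points (line a i) k.+1%:R.
    have lineE t : line (set_coord a i t) i = line a i.
      by apply/funext => u; rewrite /line set_coordK.
    by apply/seteqP; split => t; rewrite /bad /= tnth_set_coord eqxx lineE.
  apply/eqP; rewrite eq_le measure_ge0 andbT; apply/lee_addgt0Pr => e e0.
  rewrite add0e.
  have [k ke] : exists k : nat, 12 / k.+1%:R < e.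
    exists (Num.truncn (12 / e)).
    by rewrite ltr_pdivrMr// mulrC -ltr_pdivrMr// truncnS_gt.
  apply: (@le_trans _ _ (lebesgue_measure (bad_points (line a i) k.+1%:R))).
    apply: le_measure; rewrite ?inE.
    - rewrite (_ : [set _ | _] = \bigcap_k bad_points (line a i) k.+1%:R).
        apply: bigcap_measurable => // j _.
        apply: measurable_realfun.open_measurable.
        by apply: bad_points_open; exact: line_lipschitz.
      by apply/seteqP; split => t H j _; have := H j Logic.I; rewrite -slice.
    - apply: measurable_realfun.open_measurable.
      by apply: bad_points_open; exact: line_lipschitz.
    - by move=> t /(_ k Logic.I); rewrite -slice.
  have := measure_bad_points (@G_convex a i) (@line_lipschitz a i)
    (ltr0Sn _ k : 0 < k.+1%:R :> R).
  by move=> /le_trans; apply; rewrite lee_fin ltW.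
have [mU U0] : measurable (\big[setU/set0]_(i < N) B i) /\
    lebesgue_tuple (\big[setU/set0]_(i < N) B i) = 0%E.
  elim/big_ind : _ => [|X Y [mX X0] [mY Y0]|i _]; first by rewrite measure0.
    split; first exact: measurableU.
    apply/eqP; rewrite eq_le measure_ge0 andbT.
    apply: (le_trans (measureU2 _ mX mY)); rewrite -[leRHS]adde0.
    by apply: leeD; rewrite le_eqVlt; apply/orP; left; apply/eqP;
      [exact: X0|exact: Y0].
  by split; [exact: mB|exact: B0].
exists (\big[setU/set0]_(i < N) B i); split => // a Ba.
have /all_sig[k ka] : forall i, {k : nat | ~ bad i k.+1%:R a}.
  move=> i; apply: cid; apply/not_existsP => H; apply: Ba.
  rewrite -bigcup_seq; exists i; first by rewrite /= mem_index_enum.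
  move=> k _; apply: contrapT; exact: H.
(* The sum dominates the constants of all axes; the 1 keeps it positive when there are none. *)
exists (\sum_i (k i).+1%:R + 1) => [|i s s0 s1].
  by rewrite ltr_pwDr// sumr_ge0.
rewrite -second_diff_line leNgt; apply/negP => H; apply: (ka i).
exists s; split => //; apply: le_lt_trans H.
rewrite ler_wpM2r ?sqr_ge0// (bigD1 i)//= -addrA lerDl addr_ge0//.
exact: sumr_ge0.
Qed.

End AeSecondDiff.
End NullSlices.

(** * Positive semidefinite quadratic forms *)

Section QuadraticForms.
Variable R : rcfType.

Lemma sum_pairs_recl (V : nmodType) n (F : 'I_n.+1 -> 'I_n.+1 -> V) :
  \sum_i \sum_j F i j = F ord0 ord0 +
    \sum_j (F ord0 (lift ord0 j) + F (lift ord0 j) ord0) +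
    \sum_i \sum_j F (lift ord0 i) (lift ord0 j).
Proof.
rewrite big_ord_recl /= big_ord_recl /=.
under [X in _ + X = _]eq_bigr => i _ do rewrite big_ord_recl.
by rewrite !big_split/= !addrA.
Qed.

(* Completing the square; [r] is the square root of the first diagonal entry. *)
Lemma quad_form_recl (B : comPzRingType) (phi : {rmorphism R -> B}) n
    (M : 'I_n.+1 -> 'I_n.+1 -> R) (r : R) (c : 'I_n -> R) (w : 'I_n.+1 -> B) :
  M ord0 ord0 = r ^+ 2 ->
  (forall j, M ord0 (lift ord0 j) + M (lift ord0 j) ord0 = 2 * (r * c j)) ->
  \sum_i \sum_j phi (M i j) * (w i * w j) =
  (phi r * w ord0 + \sum_i phi (c i) * w (lift ord0 i)) ^+ 2 +
  \sum_i \sum_j phi (M (lift ord0 i) (lift ord0 j) - c i * c j) *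
     (w (lift ord0 i) * w (lift ord0 j)).
Proof.
move=> M00 M0j; rewrite sum_pairs_recl M00 rmorphXn/=.
have -> : \sum_(j < n) (phi (M ord0 (lift ord0 j)) * (w ord0 * w (lift ord0 j)) +
      phi (M (lift ord0 j) ord0) * (w (lift ord0 j) * w ord0)) =
    2 * (phi r * w ord0) * (\sum_i phi (c i) * w (lift ord0 i)).
  rewrite mulr_sumr; apply: eq_bigr => j _ /=.
  have := congr1 phi (M0j j); rewrite rmorphD !rmorphM rmorph_nat => E.
  transitivity ((2 * (phi r * phi (c j))) * (w ord0 * w (lift ord0 j))); last by ring.
  by rewrite -E; ring.
have -> : \sum_i \sum_j phi (M (lift ord0 i) (lift ord0 j) - c i * c j) *
     (w (lift ord0 i) * w (lift ord0 j)) =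
   \sum_i \sum_j phi (M (lift ord0 i) (lift ord0 j)) *
     (w (lift ord0 i) * w (lift ord0 j)) - (\sum_i phi (c i) * w (lift ord0 i)) ^+ 2.
  rewrite expr2 mulr_suml -sumrB; apply: eq_bigr => i _.
  rewrite mulr_sumr -sumrB; apply: eq_bigr => j _.
  by rewrite rmorphB rmorphM; ring.
by ring.
Qed.

(** Lagrange reduction; [M] need not be symmetric, as only M i j + M j i enters. The linear forms
    are found over the reals, while the identity holds over any target of [phi], so that polynomials
    can be substituted for the variables. *)
Lemma psd_sum_of_squares n (M : 'I_n -> 'I_n -> R) :
  (forall w : 'I_n -> R, 0 <= \sum_i \sum_j M i j * (w i * w j)) ->
  exists cs : seq ('I_n -> R),
    forall (B : comPzRingType) (phi : {rmorphism R -> B}) (w : 'I_n -> B),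
    \sum_i \sum_j phi (M i j) * (w i * w j) =
    \sum_(c <- cs) (\sum_i phi (c i) * w i) ^+ 2.
Proof.
elim: n M => [|n IH] M psd.
  by exists [::] => B phi w; rewrite big_ord0 big_nil.
pose ext s (w : 'I_n -> R) (i : 'I_n.+1) := if unlift ord0 i is Some k then w k else s.
have ext0 s w : ext s w ord0 = s by rewrite /ext unlift_none.
have extl s w k : ext s w (lift ord0 k) = w k by rewrite /ext liftK.
pose b j := (M ord0 (lift ord0 j) + M (lift ord0 j) ord0) / 2.
pose r := Num.sqrt (M ord0 ord0).
pose c j := b j / r.
have two j s : M ord0 ord0 * s ^+ 2 + 2 * s * b j +
    M (lift ord0 j) (lift ord0 j) >= 0.
  have := psd (ext s (fun k => (k == j)%:R)).
  rewrite sum_pairs_recl ext0; congr (0 <= _); congr (_ + _ + _).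
  - rewrite (bigD1 j)//= big1 => [|k /negbTE kj]; rewrite extl.
      by rewrite eqxx /b /=; field.
    by rewrite kj /=; ring.
  - rewrite (bigD1 j)//= [X in _ + X]big1 => [|k /negbTE kj]; last first.
      by rewrite big1// => l _; rewrite extl kj /=; ring.
    rewrite (bigD1 j)//= big1 => [|k /negbTE kj].
      by rewrite !extl eqxx /=; ring.
    by rewrite (extl _ _ k) kj /=; ring.
have M00 : 0 <= M ord0 ord0.
  have := psd (ext 1 (fun=> 0)); rewrite sum_pairs_recl ext0.
  rewrite big1 => [|k _]; last by rewrite extl; ring.
  rewrite big1 => [|k _]; last by rewrite big1// => l _; rewrite extl; ring.
  by rewrite !mulr1 !addr0.
have r2 : M ord0 ord0 = r ^+ 2 by rewrite sqr_sqrtr.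
have rc j : r * c j = b j.
  rewrite /c; have [r0|r0] := eqVneq r 0; last by rewrite mulrCA divff ?mulr1.
  (* With zero first diagonal entry, [two] is affine in [s] with slope 2 b j; if [b j] were nonzero,
     the [s] below would give the value -1. *)
  rewrite r0 mul0r; apply/esym/eqP; apply/negPn/negP => b0.
  have M0 : M ord0 ord0 = 0 by rewrite r2 r0 expr0n.
  have := two j (- (M (lift ord0 j) (lift ord0 j) + 1) / (2 * b j)).
  rewrite M0 mul0r add0r (_ : _ + _ = - 1); last by field.
  by rewrite oppr_ge0 ler10.
have cross j : M ord0 (lift ord0 j) + M (lift ord0 j) ord0 = 2 * (r * c j).
  by rewrite rc /b; field.
have [w|cs csE] := IH (fun i j => M (lift ord0 i) (lift ord0 j) - c i * c j).
  (* This value cancels the completed square and leaves the reduced form; if [r] is 0, then [c] is 0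
     and the square vanishes anyway. *)
  pose s := - (\sum_i c i * w i) / r.
  have := psd (ext s w).
  have /= -> := quad_form_recl (idfun : {rmorphism R -> R}) (ext s w) r2 cross; rewrite ext0.
  under eq_bigr => i _ do rewrite extl.
  under [X in _ + X]eq_bigr => i _ do under eq_bigr => j _ do rewrite !extl.
  rewrite (_ : r * s + _ = 0) ?expr0n ?add0r//=.
  rewrite /s; have [r0|r0] := eqVneq r 0; last by field.
  rewrite big1 ?mulr0 ?oppr0 ?mul0r ?addr0// ?r0 ?mul0r// => i _.
  by rewrite /c r0 invr0 mulr0 mul0r.
exists (ext r c :: [seq ext 0 c' | c' <- cs]) => B phi w.
rewrite (quad_form_recl phi w r2 cross) big_cons big_map csE; congr (_ ^+ 2 + _).
  rewrite big_ord_recl ext0; congr (_ + _).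
  by apply: eq_bigr => i _; rewrite extl.
apply: eq_bigr => c' _; congr (_ ^+ 2).
rewrite big_ord_recl ext0 rmorph0 mul0r add0r.
by apply: eq_bigr => i _; rewrite extl.
Qed.

End QuadraticForms.

(** * The archimedean Positivstellensatz *)

Section Positivstellensatz.
Variables (R : realType) (n : nat).
Local Notation A := {mpoly R[n]}.
Implicit Types (T P : set A) (a b f : A) (c e : R).
Local Notation C := (@mpolyC n R).

Lemma mpoly_ring_ind (Q : A -> Prop) :
  (forall c, Q (C c)) -> (forall i, Q 'X_i) ->
  (forall a b, Q a -> Q b -> Q (a + b)) ->
  (forall a b, Q a -> Q b -> Q (a * b)) -> forall a, Q a.
Proof.
move=> QC QX QD QM.
have Q1 : Q 1 by rewrite -mpolyC1.
apply: mpolyind => [|c m p _ _ Qp]; first by rewrite -mpolyC0; exact: QC.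
apply: (QD) => //; rewrite -mul_mpolyC; apply: (QM) => //.
rewrite mpolyXE_id; apply: big_ind => // i _.
by elim: (m i) => [|k IH]; rewrite ?expr0// exprS; exact: QM.
Qed.

Record preordering T : Prop := Preordering {
  preorderingD : forall a b, T a -> T b -> T (a + b);
  preorderingM : forall a b, T a -> T b -> T (a * b);
  preordering_sqr : forall a, T (a ^+ 2) }.

Lemma preorderingC T c : preordering T -> 0 <= c -> T (C c).
Proof.
by move=> pT c0; rewrite -(sqr_sqrtr c0) rmorphXn; exact: preordering_sqr.
Qed.

Lemma preordering0 T : preordering T -> T 0.
Proof. by move=> /preordering_sqr/(_ 0); rewrite expr0n. Qed.

Lemma preordering1 T : preordering T -> T 1.
Proof. by move=> /preordering_sqr/(_ 1); rewrite expr1n. Qed.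

Lemma preorderingZ T c a : preordering T -> 0 <= c -> T a -> T (C c * a).
Proof. by move=> pT c0; apply: preorderingM => //; exact: preorderingC. Qed.

Definition archimedean T := forall a, exists N, T (C N - a).

Lemma archimedean_bound T a : preordering T -> archimedean T ->
  exists2 N, 0 < N & T (C N - a) /\ T (C N + a).
Proof.
move=> pT arT; have [N1 h1] := arT a; have [N2 h2] := arT (- a).
pose N := `|N1| + `|N2| + 1.
have up N0 b : N0 <= N -> T (C N0 - b) -> T (C N - b).
  move=> le; rewrite (_ : C N - b = C (N - N0) + (C N0 - b)).
    by apply: preorderingD => //; apply: preorderingC => //; rewrite subr_ge0.
  by rewrite rmorphB; ring.
exists N; first by rewrite ltr_pwDr// addr_ge0.
split; first by apply: up h1; rewrite /N -addrA ler_wpDr ?ler_norm// addr_ge0.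
rewrite -[X in _ + X]opprK; apply: up h2.
by rewrite /N addrAC ler_wpDl ?ler_norm// addr_ge0.
Qed.

(** A preordering maximal among those without -1 is total: if it contained neither [a] nor [- a],
    adjoining either would produce -1, and the two relations multiply to a contradiction. *)
Lemma preordering_total_extension T : preordering T -> ~ T (- 1) ->
  exists P, [/\ preordering P, T `<=` P, ~ P (- 1) & forall a, P a \/ P (- a)].
Proof.
move=> pT T1.
pose good P := P = set0 \/ [/\ preordering P, T `<=` P & ~ P (- 1)].
have T0 : T 0 by exact: preordering0.
have good_mem P a : good P -> P a -> [/\ preordering P, T `<=` P & ~ P (- 1)].
  by move=> [->|].
have [|P [gP maxP]] := @Zorn_bigcup _ good.
  move=> F Fgood totF.
  have [[P FP [a Pa]]|F0] := pselect (exists2 P, F P & P !=set0); last first.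
    left; apply/seteqP; split => // a [P FP Pa].
    by case: F0; exists P => //; exists a.
  right; have [pP TP _] := good_mem _ _ (Fgood _ FP) Pa.
  have common b b' : (\bigcup_(X in F) X) b -> (\bigcup_(X in F) X) b' ->
      exists2 Q, F Q & Q b /\ Q b'.
    move=> [Q FQ Qb] [Q' FQ' Q'c].
    by have [QQ'|Q'Q] := totF _ _ FQ FQ'; [exists Q'|exists Q] => //; split;
      [exact: QQ'| | |exact: Q'Q].
  split; last 2 first.
  - by move=> b /TP Pb; exists P.
  - by move=> [Q FQ Q1]; have [_ _] := good_mem _ _ (Fgood _ FQ) Q1; exact.
  split.
  - move=> b c hb hc; have [Q FQ [Qb Qc]] := common _ _ hb hc.
    exists Q => //; have [pQ _ _] := good_mem _ _ (Fgood _ FQ) Qb.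
    exact: preorderingD.
  - move=> b c hb hc; have [Q FQ [Qb Qc]] := common _ _ hb hc.
    exists Q => //; have [pQ _ _] := good_mem _ _ (Fgood _ FQ) Qb.
    exact: preorderingM.
  - by move=> b; exists P => //; exact: preordering_sqr.
have {gP} [P0|[pP TP P1]] := gP.
  case: (maxP T); last by right; split.
  by rewrite P0; split => // /(_ 0 T0).
exists P; split => // a.
have ext b : ~ P b -> exists p q, [/\ P p, P q & - 1 = p + b * q].
  move=> Pb; pose Q := [set r | exists p q, [/\ P p, P q & r = p + b * q]].
  have P_0 : P 0 by exact: TP.
  have P_1 : P 1 by exact: preordering1.
  have PQ : P `<=` Q by move=> p Pp; exists p, 0; split => //; rewrite mulr0 addr0.
  apply: contrapT => Q1; apply: (maxP Q).
    split=> // QP; apply/Pb/QP; exists 0, 1; split => //; ring.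
  right; split => //; last by move=> t /TP /PQ.
  split.
  - move=> _ _ [p1 [q1 [? ? ->]]] [p2 [q2 [? ? ->]]].
    by exists (p1 + p2), (q1 + q2); split; [exact: preorderingD| exact: preorderingD| ring].
  - move=> _ _ [p1 [q1 [? ? ->]]] [p2 [q2 [? ? ->]]].
    exists (p1 * p2 + b ^+ 2 * (q1 * q2)), (p1 * q2 + p2 * q1); split.
    + apply: preorderingD => //; first exact: preorderingM.
      apply: preorderingM => //; [exact: preordering_sqr|exact: preorderingM].
    + by apply: preorderingD => //; exact: preorderingM.
    + by ring.
  - by move=> r; apply: PQ; exact: preordering_sqr.
have [|Pa] := pselect (P a); first by left.
have [|PNa] := pselect (P (- a)); first by right.
have [p1 [q1 [Pp1 Pq1 E1]]] := ext _ Pa.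
have [p2 [q2 [Pp2 Pq2 E2]]] := ext _ PNa.
exfalso; apply: P1.
(* Product of 1 + p1 = - a q1 and 1 + p2 = a q2. *)
have -> : -1 = p1 + p2 + p1 * p2 + a ^+ 2 * (q1 * q2).
  have e1 : a * q1 = - 1 - p1 by rewrite E1; ring.
  have e2 : a * q2 = 1 + p2.
    by transitivity (p2 - (p2 + - a * q2)); [ring|rewrite -E2; ring].
  have -> : a ^+ 2 * (q1 * q2) = (a * q1) * (a * q2) by ring.
  by rewrite e1 e2; ring.
apply: preorderingD => //; last first.
  apply: preorderingM => //; [exact: preordering_sqr|exact: preorderingM].
by apply: preorderingD => //; [exact: preorderingD|exact: preorderingM].
Qed.

Lemma preordering_const P c : preordering P -> ~ P (- 1) -> P (C c) -> 0 <= c.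
Proof.
move=> pP P1 Pc; rewrite leNgt; apply/negP => c0; apply: P1.
have -> : - 1 = C (- c^-1) * C c.
  by rewrite -rmorphM mulNr mulVf ?lt_eqF// rmorphN rmorph1.
by apply: preorderingZ => //; rewrite oppr_ge0 invr_le0 ltW.
Qed.

(* The elements of [P] infinitely close to 0 form an ideal, and modulo this ideal
   every polynomial is congruent to its value at one point. *)
Lemma preordering_point P : preordering P -> archimedean P -> ~ P (- 1) ->
  (forall a, P a \/ P (- a)) -> exists x : 'I_n -> R, forall a, P a -> 0 <= meval x a.
Proof.
move=> pP arP P1 totP.
pose J a := forall e, 0 < e -> P (C e + a) /\ P (C e - a).
have JD a b : J a -> J b -> J (a + b).
  move=> Ja Jb e e0; have e20 : 0 < e / 2 by rewrite divr_gt0.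
  have [a1 a2] := Ja _ e20; have [b1 b2] := Jb _ e20.
  have Ce : C e = C (e / 2) + C (e / 2) by rewrite -rmorphD; congr C; field.
  split; [have := preorderingD pP a1 b1|have := preorderingD pP a2 b2];
  by congr P; rewrite Ce; ring.
have JM a b : J a -> J (a * b).
  move=> Ja e e0; have [N N0 [b1 b2]] := archimedean_bound b pP arP.
  have d0 : 0 < e / N by rewrite divr_gt0.
  have [a1 a2] := Ja _ d0.
  have Ce : C e = C N * C (e / N) by rewrite -rmorphM; congr C; field; rewrite gt_eqF.
  have half b' : b' = C 2^-1 * (2 * b').
    rewrite mulrA -mpolyC_nat -rmorphM mulVf// rmorph1 mul1r//.
  split.
  - rewrite [X in P X]half; apply: preorderingZ => //; rewrite Ce.
    have -> : 2 * (C N * C (e / N) + a * b) =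
      (C N + b) * (C (e / N) + a) + (C N - b) * (C (e / N) - a) by ring.
    by apply: preorderingD => //; exact: preorderingM.
  - rewrite [X in P X]half; apply: preorderingZ => //; rewrite Ce.
    have -> : 2 * (C N * C (e / N) - a * b) =
      (C N + b) * (C (e / N) - a) + (C N - b) * (C (e / N) + a) by ring.
    by apply: preorderingD => //; exact: preorderingM.
(* Each coordinate of the point is the supremum of a Dedekind cut. *)
pose S i : set R := [set r | P ('X_i - C r)].
have supS i : has_sup (S i).
  have [N N0 [b1 b2]] := archimedean_bound 'X_i pP arP; split.
    by exists (- N); rewrite /S /= rmorphN opprK addrC.
  exists N => r Sr; rewrite -subr_ge0; apply: (preordering_const pP P1).
  by have := preorderingD pP b1 Sr; congr P; rewrite rmorphB; ring.
pose x i := sup (S i).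
have JX i : J ('X_i - C (x i)).
  move=> e e0; split.
    have [r Sr xr] := sup_adherent e0 (supS i).
    have -> : C e + ('X_i - C (x i)) = C (e - x i + r) + ('X_i - C r).
      by rewrite rmorphD rmorphB; ring.
    apply: preorderingD => //; apply: preorderingC => //.
    by rewrite -(subrr (x i)) /x; lra.
  have [H|H] := totP (C e - ('X_i - C (x i))) => //.
  have : x i + e <= x i.
    apply: (ub_le_sup (supS i).2); rewrite /S /=.
    by move: H; congr P; rewrite rmorphD; ring.
  by rewrite gerDl leNgt e0.
have Jx a : J (a - C (meval x a)).
  move: a; apply: mpoly_ring_ind => [c|i|a b Ja Jb|a b Ja Jb].
  - rewrite mevalC subrr => e e0; rewrite addr0 subr0.
    by split; apply: preorderingC => //; exact: ltW.
  - by rewrite mevalXU.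
  - rewrite mevalD rmorphD.
    by have := JD _ _ Ja Jb; congr J; ring.
  - rewrite mevalM rmorphM.
    have := JD _ _ (JM _ b Ja) (JM _ (C (meval x a)) Jb); congr J; ring.
exists x => a Pa; rewrite leNgt; apply/negP => ax.
have a20 : 0 < - meval x a / 2 by rewrite divr_gt0// oppr_gt0.
(* If a(x) < 0, then adding [a] to e - (a - a(x)) with e = - a(x) / 2 puts the negative constant
   a(x) / 2 in [P]. *)
have [_ H] := Jx a _ a20.
have : 0 <= meval x a / 2.
  apply: (preordering_const pP P1); have := preorderingD pP Pa H; congr P.
  have -> : meval x a / 2 = - meval x a / 2 + meval x a by field.
  by rewrite rmorphD; ring.
lra.
Qed.

(** If the preordering T - f T omits -1, a total extension yields a point where [T] is nonnegative
    and [f] is not positive. Otherwise f t2 = 1 + t1 with t1, t2 in [T], and the factor t2 is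
    removed by a descent. *)
Theorem positivstellensatz T f : preordering T -> archimedean T ->
  (forall x, (forall t, T t -> 0 <= meval x t) -> 0 < meval x f) ->
  exists2 e, 0 < e & T (f - C e).
Proof.
move=> pT arT f0; apply: contrapT => /forall2NP fN.
pose T1 := [set a | exists t s, [/\ T t, T s & a = t - f * s]].
have T0 : T 0 by exact: preordering0.
have T_1 : T 1 by exact: preordering1.
have TT1 : T `<=` T1 by move=> t Tt; exists t, 0; split => //; rewrite mulr0 subr0.
have pT1 : preordering T1.
  split.
  - move=> _ _ [p1 [q1 [? ? ->]]] [p2 [q2 [? ? ->]]].
    by exists (p1 + p2), (q1 + q2); split; [exact: preorderingD| exact: preorderingD| ring].
  - move=> _ _ [p1 [q1 [? ? ->]]] [p2 [q2 [? ? ->]]].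
    exists (p1 * p2 + f ^+ 2 * (q1 * q2)), (p1 * q2 + p2 * q1); split.
    + apply: preorderingD => //; first exact: preorderingM.
      apply: preorderingM => //; [exact: preordering_sqr|exact: preorderingM].
    + by apply: preorderingD => //; exact: preorderingM.
    + by ring.
  - by move=> r; apply: TT1; exact: preordering_sqr.
have [[t1 [t2 [Tt1 Tt2 E]]]|T1N] := pselect (T1 (- 1)).
  have {}E : f * t2 = 1 + t1 by transitivity (t1 - (t1 - f * t2)); [ring|rewrite -E; ring].
  have [N N0 [Nt2 _]] := archimedean_bound t2 pT arT.
  (* Since f t2 = 1 + t1, the element (N - t2)(f + r) + t1 + r t2 of [T] equals N (f + r) - 1.
     Starting from a multiple of 1 / N above a bound for [f], the constant descends to -1 / N. *)
  have step (r : R) : 0 <= r -> T (f + C r) -> T (f + C (r - N^-1)).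
    move=> r0 fr.
    have -> : f + C (r - N^-1) = C N^-1 * ((C N - t2) * (f + C r) + (t1 + C r * t2)).
      have -> : (C N - t2) * (f + C r) + (t1 + C r * t2) =
        C N * (f + C r) - 1 + (1 + t1 - f * t2) by ring.
      rewrite E subrr addr0 mulrBr mulrA -rmorphM mulVf ?gt_eqF//.
      by rewrite rmorph1 mul1r mulr1 rmorphB; ring.
    apply: preorderingZ => //; first by rewrite invr_ge0 ltW.
    apply: preorderingD => //; first exact: preorderingM.
    by apply: preorderingD => //; exact: preorderingZ.
  have [M M0 [_ fM]] := archimedean_bound f pT arT.
  have desc (k : nat) : T (f + C (k%:R / N)) -> T (f + C (- N^-1)).
    elim: k => [|k IH] H.
      by rewrite -[- _]add0r; apply: step => //; move: H; rewrite mul0r.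
    apply: IH; have := step _ _ H; rewrite divr_ge0 ?ltW// => /(_ isT).
    by congr T; congr (_ + C _); rewrite -natr1; field; rewrite gt_eqF.
  case: (fN N^-1); [by rewrite invr_gt0|apply].
  have := @desc (Num.truncn (M * N)).+1; rewrite rmorphN; apply.
  set k := _.+1.
  have -> : f + C (k%:R / N) = C (k%:R / N - M) + (C M + f).
    by rewrite rmorphB; ring.
  apply: preorderingD => //; apply: preorderingC => //.
  by rewrite subr_ge0 ler_pdivlMr// ltW// truncnS_gt.
have [P [pP T1P P1 totP]] := preordering_total_extension pT1 T1N.
have [|x xP] := preordering_point pP _ P1 totP.
  by move=> a; have [N Na] := arT a; exists N; exact/T1P/TT1.
have : 0 < meval x f by apply: f0 => t Tt; exact/xP/T1P/TT1.
have : 0 <= meval x (- f).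
  by apply/xP/T1P; exists 0, 1; split => //; ring.
by rewrite mevalN; lra.
Qed.

End Positivstellensatz.

(** * Sums of squares modulo the sphere *)

Section SphereCone.
Variables (R : realType) (n : nat).
Local Notation A := {mpoly R[n]}.
Implicit Types (a b f g h : A).
Local Notation C := (@mpolyC n R).
Local Notation sp := (@sphere_poly R n).
Local Notation S := (@sphere R n).

Lemma is_sosD a b : is_sos a -> is_sos b -> is_sos (a + b).
Proof. by move=> [s ->] [t ->]; exists (s ++ t); rewrite big_cat. Qed.

Lemma is_sosM a b : is_sos a -> is_sos b -> is_sos (a * b).
Proof.
move=> [s ->] [t ->]; exists [seq x * y | x <- s, y <- t].
rewrite big_allpairs_dep mulr_suml; apply: eq_bigr => x _.
by rewrite mulr_sumr; apply: eq_bigr => y _; rewrite exprMn.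
Qed.

Lemma is_sos_sqr a : is_sos (a ^+ 2).
Proof. by exists [:: a]; rewrite big_seq1. Qed.

Lemma is_sos0 : is_sos (0 : A).
Proof. by exists [::]; rewrite big_nil. Qed.

Lemma is_sos_ge0 a x : is_sos a -> 0 <= meval x a.
Proof.
move=> [s ->]; rewrite rmorph_sum sumr_ge0// => b _.
by rewrite rmorphXn sqr_ge0.
Qed.

Lemma meval_sphere_poly x : S x -> meval x sp = 0.
Proof.
move=> Sx; rewrite /sphere_poly rmorphB rmorph1 rmorph_sum/= -Sx.
by apply/eqP; rewrite subr_eq0; apply/eqP/eq_bigr => i _; rewrite rmorphXn/= mevalXU.
Qed.

(* The preordering of the semialgebraic set of the points of the sphere where
   [g] is nonnegative. *)
Definition sphere_cone g : set A :=
  [set a | exists s t h, [/\ is_sos s, is_sos t & a = s + t * g + h * sp]].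

Lemma sphere_cone_preordering g : preordering (sphere_cone g).
Proof.
split.
- move=> _ _ [s1 [t1 [h1 [S1 T1 ->]]]] [s2 [t2 [h2 [S2 T2 ->]]]].
  by exists (s1 + s2), (t1 + t2), (h1 + h2); split; [exact: is_sosD|exact: is_sosD|ring].
- move=> _ _ [s1 [t1 [h1 [S1 T1 ->]]]] [s2 [t2 [h2 [S2 T2 ->]]]].
  exists (s1 * s2 + g ^+ 2 * (t1 * t2)), (s1 * t2 + t1 * s2),
    (h1 * (s2 + t2 * g + h2 * sp) + (s1 + t1 * g) * h2); split; last by ring.
  + apply: is_sosD; first exact: is_sosM.
    by apply: is_sosM; [exact: is_sos_sqr|exact: is_sosM].
  + by apply: is_sosD; exact: is_sosM.
- move=> a; exists (a ^+ 2), 0, 0.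
  by split; [exact: is_sos_sqr|exact: is_sos0|ring].
Qed.

Let pS g := sphere_cone_preordering g.

Lemma sphere_cone_ideal g h : sphere_cone g (h * sp).
Proof. by exists 0, 0, h; split; [exact: is_sos0|exact: is_sos0|ring]. Qed.

Lemma sphere_cone_sum g (I : Type) (r : seq I) (F : I -> A) :
  (forall i, sphere_cone g (F i)) -> sphere_cone g (\sum_(i <- r) F i).
Proof.
move=> HF; apply: big_ind => //; first exact: preordering0 (pS g).
exact: preorderingD (pS g).
Qed.

(** Modulo the sphere, 1 - X_i^2 is the sum of the other squares, which bounds X_i; bounded elements
    are closed under sums and products. *)
Lemma sphere_cone_archimedean g : archimedean (sphere_cone g).
Proof.
set T := sphere_cone g; have pT : preordering T by exact: pS.
suff H a : exists N, T (C N - a) /\ T (C N + a).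
  by move=> a; have [N [? _]] := H a; exists N.
have half b : b = C 2^-1 * (2 * b).
  by rewrite mulrA -mpolyC_nat -rmorphM mulVf// rmorph1 mul1r.
move: a; apply: mpoly_ring_ind =>
  [c|i|a b [N [N1 N2]] [M [M1 M2]]|a b [N [N1 N2]] [M [M1 M2]]].
- exists `|c|; rewrite -rmorphB -rmorphD; split; apply: preorderingC => //.
    by rewrite subr_ge0 ler_norm.
  by rewrite -lerBlDl sub0r lerNl -normrN ler_norm.
- exists 1.
  have H : T (1 - 'X_i ^+ 2).
    have -> : 1 - 'X_i ^+ 2 = \sum_(j | j != i) 'X_j ^+ 2 + (- 1) * sp :> A.
      by rewrite /sphere_poly [X in _ * (X - 1)](bigD1 i)//=; ring.
    apply: preorderingD => //; last exact: sphere_cone_ideal.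
    by rewrite big_mkcond; apply: sphere_cone_sum => j; case: ifP => _;
      [exact: preordering_sqr|exact: preordering0].
  rewrite rmorph1; split; rewrite [X in T X]half; apply: preorderingZ => //.
    have -> : 2 * (1 - 'X_i) = (1 - 'X_i) ^+ 2 + (1 - 'X_i ^+ 2) :> A by ring.
    by apply: preorderingD => //; exact: preordering_sqr.
  have -> : 2 * (1 + 'X_i) = (1 + 'X_i) ^+ 2 + (1 - 'X_i ^+ 2) :> A by ring.
  by apply: preorderingD => //; exact: preordering_sqr.
- exists (N + M); rewrite rmorphD; split.
    by have := preorderingD pT N1 M1; congr T; ring.
  by have := preorderingD pT N2 M2; congr T; ring.
- exists (N * M); rewrite rmorphM.
  split; rewrite [X in T X]half; apply: preorderingZ => //.
    have -> : 2 * (C N * C M - a * b) =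
      (C N - a) * (C M + b) + (C N + a) * (C M - b) by ring.
    by apply: preorderingD => //; exact: preorderingM.
  have -> : 2 * (C N * C M + a * b) =
    (C N + a) * (C M + b) + (C N - a) * (C M - b) by ring.
  by apply: preorderingD => //; exact: preorderingM.
Qed.

Lemma sphere_cone_ge0 g a x : S x -> 0 <= meval x g -> sphere_cone g a ->
  0 <= meval x a.
Proof.
move=> Sx gx [s [t [h [Ss St ->]]]].
rewrite !rmorphD !rmorphM/= meval_sphere_poly// mulr0 addr0.
apply: addr_ge0; first exact: is_sos_ge0.
by apply: mulr_ge0 => //; exact: is_sos_ge0.
Qed.

Lemma sphere_cone_point g x : (forall t, sphere_cone g t -> 0 <= meval x t) ->
  S x /\ 0 <= meval x g.
Proof.
move=> H; split; last first.
  apply: H; exists 0, (1 ^+ 2), 0; split; [exact: is_sos0|exact: is_sos_sqr|ring].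
have h1 := H _ (sphere_cone_ideal g 1); have h2 := H _ (sphere_cone_ideal g (- 1)).
have sp0 : meval x sp = 0.
  by move: h1 h2; rewrite !rmorphM rmorphN rmorph1; lra.
move: sp0; rewrite /sphere_poly rmorphB rmorph1 rmorph_sum/= => /eqP.
rewrite subr_eq0 => /eqP H1; rewrite /sphere /= -H1; apply: eq_bigr => i _.
by rewrite rmorphXn/= mevalXU.
Qed.

(** The slack in the Positivstellensatz is a uniform lower bound; it does the work of
    compactness. *)
Lemma sphere_gt0_lower_bound g a :
  (forall x, S x -> 0 <= meval x g -> 0 < meval x a) ->
  exists2 e, 0 < e & forall x, S x -> 0 <= meval x g -> e <= meval x a.
Proof.
move=> a0; have [|e e0 Te] := positivstellensatz (pS g) (@sphere_cone_archimedean g)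
  (f := a).
  by move=> x /sphere_cone_point[Sx gx]; exact: a0.
exists e => // x Sx gx; have := sphere_cone_ge0 Sx gx Te.
by rewrite rmorphB/= mevalC subr_ge0.
Qed.

Lemma sphere_bounded a : exists2 N, 0 < N & forall x, S x -> `|meval x a| <= N.
Proof.
have [N N0 [N1 N2]] := archimedean_bound a (pS 0) (@sphere_cone_archimedean 0).
exists N => // x Sx; rewrite ler_norml.
have := sphere_cone_ge0 Sx _ N1; have := sphere_cone_ge0 Sx _ N2.
by rewrite rmorph0 lexx rmorphD rmorphB/= mevalC => /(_ isT) ? /(_ isT) ?;
  apply/andP; split; lra.
Qed.

Lemma sphere_gt0_sos a : (forall x, S x -> 0 < meval x a) -> sphere_cone 0 a.
Proof.
move=> a0; have [|e e0 Te] := positivstellensatz (pS 0) (@sphere_cone_archimedean 0)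
  (f := a).
  by move=> x /sphere_cone_point[Sx _]; exact: a0.
rewrite -[a](subrK (C e)); apply: preorderingD => //.
by apply: preorderingC => //; exact: ltW.
Qed.

(** If the infimum were not attained, [a] minus it would be positive on the sphere, hence bounded
    away from 0. *)
Lemma sphere_min a x0 : S x0 ->
  exists2 p, S p & forall x, S x -> meval p a <= meval x a.
Proof.
move=> S0; have [N N0 aN] := sphere_bounded a.
pose V := [set meval x a | x in S].
have infV : has_inf V.
  split; first by exists (meval x0 a), x0.
  exists (- N) => _ [x Sx <-].
  by have := aN _ Sx; rewrite ler_norml => /andP[].
have lbV x : S x -> inf V <= meval x a.
  by move=> Sx; apply: (ge_inf infV.2); exists x.
apply: contrapT => /forall2NP noMin.
have [|e e0 He] := @sphere_gt0_lower_bound 0 (a - C (inf V)).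
  move=> x Sx _; rewrite rmorphB/= mevalC subr_gt0 lt_neqAle lbV// andbT.
  apply/eqP => E; have [|] := noMin x; first by [].
  by apply=> y Sy; rewrite -E lbV.
have [_ [x Sx <-] xV] := inf_adherent e0 infV.
by have := He _ Sx; rewrite rmorph0 lexx rmorphB/= mevalC => /(_ isT); lra.
Qed.

End SphereCone.

(** * Making the weights of squares positive *)

Section WeightedSquares.
Variables (R : realType) (n : nat).
Local Notation A := {mpoly R[n]}.
Local Notation C := (@mpolyC n R).
Local Notation sp := (@sphere_poly R n).
Local Notation S := (@sphere R n).

Lemma expr_lt_eventually (q b : R) : 0 <= q -> q < 1 -> 0 < b ->
  exists m0, forall m, (m0 <= m)%N -> q ^+ m < b.
Proof.
move=> q0 q1 b0.
have /cvgr_lt : (q ^+ m) @[m --> \oo] --> (0 : R) by apply: cvg_expr; rewrite ger0_norm.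
by move=> /(_ _ b0) [m0 _ H]; exists m0 => m; exact: H.
Qed.

Variables (f : A) (K : seq (A * A)) (h : A) (e : R).
Let L := \sum_(k <- K) k.2 ^+ 2.
Hypothesis f_decomp : f = \sum_(k <- K) k.1 * k.2 ^+ 2 + h * sp.
Hypothesis e_gt0 : 0 < e.
Hypothesis f_ge : forall x, S x -> e * meval x L <= meval x f.
Hypothesis weight_gt0 : forall x k, S x -> meval x L = 0 -> k \in K -> 0 < meval x k.1.

Let L_ge0 x : 0 <= meval x L.
Proof.
by rewrite rmorph_sum sumr_ge0// => k _; rewrite rmorphXn sqr_ge0.
Qed.

(* Replacing the weights [s] by [new_weight s] does not change the sum modulo the
   sphere; away from the zeros of [L] it makes them close to [f / L]. *)
Let shrink c := 1 - C c * L.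
Let psi c m := C c * \sum_(j < m) shrink c ^+ j.
Let new_weight c m (s : A) := s * shrink c ^+ m + f * psi c m.

(** A geometric sum: [psi c m] is the polynomial quotient of 1 - (1 - c L)^m by L. *)
Let psiL c m : psi c m * L = 1 - shrink c ^+ m.
Proof.
rewrite -[1 - _]opprB subrX1 /psi.
by rewrite (_ : shrink c - 1 = - (C c * L)); [ring|rewrite /shrink; ring].
Qed.

Let new_weight_sum c m : f = \sum_(k <- K) new_weight c m k.1 * k.2 ^+ 2
  + (shrink c ^+ m * h) * sp.
Proof.
have -> : \sum_(k <- K) new_weight c m k.1 * k.2 ^+ 2 =
    shrink c ^+ m * (\sum_(k <- K) k.1 * k.2 ^+ 2) + f * (psi c m * L).
  rewrite /L !mulr_sumr -big_split/=; apply: eq_bigr => k _.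
  by rewrite /new_weight; ring.
have -> : \sum_(k <- K) k.1 * k.2 ^+ 2 = f - h * sp by rewrite {1}f_decomp addrK.
by rewrite psiL; ring.
Qed.

Let new_weight_gt0 c N k : 0 < c -> (forall x, S x -> meval x L <= N) -> c * N < 1 ->
  k \in K -> exists m0, forall m, (m0 <= m)%N -> forall x, S x ->
  0 < meval x (new_weight c m k.1).
Proof.
move=> c0 LN cN1 kK.
(* Where the weight is not positive, [L] is bounded below, so [shrink c] is bounded by some q < 1;
   elsewhere both terms of the new weight are nonnegative and the first is positive. *)
have [eta eta0 Leta] : exists2 eta, 0 < eta & forall x, S x ->
    0 <= meval x (- k.1) -> eta <= meval x L.
  apply: sphere_gt0_lower_bound => x Sx; rewrite rmorphN oppr_ge0 => sx.
  rewrite lt_neqAle L_ge0 andbT eq_sym; apply/eqP => Lx.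
  by have := weight_gt0 Sx Lx kK; rewrite ltNge sx.
have [M M0 sM] := sphere_bounded k.1.
pose q := Num.max 0 (1 - c * eta).
have q0 : 0 <= q by rewrite le_max lexx.
have q1 : q < 1 by rewrite gt_max ltr01/= ltrBlDr ltrDl mulr_gt0.
have Me : 0 < M + e by rewrite addr_gt0.
(* The threshold e / (M + e) gives M u^m < e (1 - u^m), and the right-hand side is at most f psi
   because f >= e L. *)
have [m0 qm] := expr_lt_eventually q0 q1 (divr_gt0 e_gt0 Me).
exists m0 => m m0m x Sx.
have -> : meval x (new_weight c m k.1) =
    meval x k.1 * meval x (shrink c) ^+ m + meval x f * meval x (psi c m).
  by rewrite /new_weight mevalD (mevalM x f) mevalM rmorphXn.
set s := meval x k.1; set u := meval x (shrink c); set p := meval x (psi c m).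
have uE : u = 1 - c * meval x L by rewrite /u /shrink rmorphB rmorphM rmorph1/= mevalC.
have u0 : 0 < u.
  by rewrite uE subr_gt0; apply: le_lt_trans cN1; rewrite ler_wpM2l ?LN// ltW.
have p0 : 0 <= p.
  rewrite /p rmorphM rmorph_sum/= mevalC mulr_ge0 ?(ltW c0)// sumr_ge0// => j _.
  by rewrite rmorphXn/= exprn_ge0// ltW.
have pL : p * meval x L = 1 - u ^+ m.
  by rewrite -rmorphM psiL rmorphB rmorph1 rmorphXn.
have fx := f_ge Sx; have Lx := L_ge0 x.
have fx0 : 0 <= meval x f by apply: le_trans fx; rewrite mulr_ge0// ltW.
have um0 : 0 < u ^+ m by rewrite exprn_gt0.
have [s0|s0] := ltP 0 s.
  by apply: ltr_pwDl; [exact: mulr_gt0|exact: mulr_ge0].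
have uq : u <= q.
  rewrite uE le_max; apply/orP; right.
  by rewrite lerD2l lerN2 ler_pM2l// Leta// rmorphN oppr_ge0.
have umq : u ^+ m <= q ^+ m by rewrite lerXn2r// ?nnegrE// ltW.
have := qm _ m0m; rewrite ltr_pdivlMr// => qme.
have : u ^+ m * (M + e) < e by apply: le_lt_trans qme; rewrite ler_pM2r.
have : - M * u ^+ m <= s * u ^+ m.
  by rewrite ler_pM2r//; have := sM _ Sx; rewrite ler_norml => /andP[].
have : e * (1 - u ^+ m) <= meval x f * p.
  by rewrite -pL mulrCA mulrC ler_wpM2r.
lra.
Qed.

Lemma weighted_squares_sos : sphere_cone 0 f.
Proof.
have [N N0 LN] := sphere_bounded L.
have N1 : 0 < N + 1 by rewrite addr_gt0.
pose c := (N + 1)^-1.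
have c0 : 0 < c by rewrite invr_gt0.
have cN1 : c * N < 1 by rewrite mulrC ltr_pdivrMr// mul1r ltrDl.
have LN' x : S x -> meval x L <= N.
  by move=> Sx; apply: le_trans (LN _ Sx); exact: ler_norm.
have [m Hm] : exists m, forall k, k \in K -> forall x, S x ->
    0 < meval x (new_weight c m k.1).
  suff [m Hm] : exists m0, forall m, (m0 <= m)%N -> forall k, k \in K ->
      forall x, S x -> 0 < meval x (new_weight c m k.1) by exists m; exact: Hm.
  have: {subset K <= K} by [].
  elim: {1 3}K => [|k K' IH] K'K; first by exists 0.
  have [|m1 H1] := IH; first by move=> l lK; apply: K'K; rewrite inE lK orbT.
  have [|m2 H2] := new_weight_gt0 c0 LN' cN1 (k := k).
    by apply: K'K; rewrite mem_head.
  exists (maxn m1 m2) => m; rewrite geq_max => /andP[m1m m2m] l.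
  by rewrite inE => /predU1P[->|]; [exact: H2|exact: H1].
rewrite (new_weight_sum c m); apply: preorderingD.
- exact: sphere_cone_preordering.
- rewrite big_seq; apply: big_ind => [|a b|k kK].
  + by apply: preordering0; exact: sphere_cone_preordering.
  + by apply: preorderingD; exact: sphere_cone_preordering.
  + apply: preorderingM; first exact: sphere_cone_preordering.
      by apply: sphere_gt0_sos => x Sx; exact: Hm.
    by apply: preordering_sqr; exact: sphere_cone_preordering.
- exact: sphere_cone_ideal.
Qed.

End WeightedSquares.

(** * Forms near a nondegenerate minimizer *)

(** Reads off the sign of the lowest coefficient of an expansion along a curve. *)
Lemma poly_ge0_at0 (R : realFieldType) (P : {poly R}) :
  (forall s, 0 < s -> 0 <= P.[s]) -> 0 <= P.[0].
Proof.
move=> P0; rewrite leNgt; apply/negP => PN.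
have [Q PQ] : exists Q, P = Q * 'X + (P.[0])%:P.
  have /factor_theorem[Q QE] : root (P - (P.[0])%:P) 0.
    by rewrite rootE !hornerE subrr.
  by exists Q; rewrite -[LHS](subrK (P.[0])%:P) QE subr0.
have [M HM] := poly_itv_bound Q 0 1.
pose s := Num.min 1 (- P.[0] / (2 * (`|M| + 1))).
have M1 : 0 < 2 * (`|M| + 1) by rewrite mulr_gt0// ltr_pwDr.
have s0 : 0 < s by rewrite lt_min ltr01/= divr_gt0// oppr_gt0.
have s1 : s <= 1 by rewrite ge_min lexx.
have sM : s * (2 * (`|M| + 1)) <= - P.[0].
  by rewrite -ler_pdivlMr// ge_min lexx orbT.
have := P0 _ s0; rewrite {1}PQ !hornerE/= => H.
have : Q.[s] * s <= (`|M| + 1) * s.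
  rewrite ler_pM2r//; apply: le_trans (ler_norm _) _.
  rewrite (le_trans (HM _ _)) ?(ltW s0) ?s1//.
  by rewrite (le_trans (ler_norm _))// lerDl.
by move: sM H PN; nra.
Qed.

Lemma sum_delta (B : pzRingType) (I : finType) (k : I) (F : I -> B) :
  \sum_i (i == k)%:R * F i = F k.
Proof.
rewrite (bigD1 k)//= big1 => [|i /negbTE ->]; last by rewrite mul0r.
by rewrite eqxx mul1r addr0.
Qed.

(** * Expansion of a form around the axis through p *)

Section Decomposition.
Variables (R : realType) (n : nat).
Local Notation A := {mpoly R[n]}.
Local Notation C := (@mpolyC n R).
Local Notation sp := (@sphere_poly R n).
Local Notation S := (@sphere R n).

Lemma meval_scale (d : nat) (f : dhomog n R d) (c : R) (x : 'I_n -> R) :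
  meval (fun i => c * x i) f = c ^+ d * meval x f.
Proof.
have /dhomogP hf := dhomog_is_dhomog f.
rewrite !mevalE mulr_sumr !big_seq; apply: eq_bigr => m mf.
rewrite mulrCA; congr (_ * _).
under eq_bigr => i _ do rewrite exprMn.
by rewrite big_split/= prodrXr -mdegE hf.
Qed.

Variable p : 'I_n -> R.
Hypothesis Sp : S p.

Definition dot_poly : A := \sum_i C (p i) * 'X_i.
Local Notation t := dot_poly.
Definition perp_poly i : A := 'X_i - C (p i) * t.
Local Notation l := perp_poly.

Lemma meval_dot_poly x : meval x t = \sum_i p i * x i.
Proof.
by rewrite rmorph_sum; apply: eq_bigr => i _; rewrite rmorphM/= mevalC mevalXU.
Qed.

Lemma meval_perp_poly x i : meval x (l i) = x i - p i * meval x t.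
Proof. by rewrite rmorphB rmorphM/= mevalC mevalXU. Qed.

Lemma sum_perp_sqr : \sum_i l i ^+ 2 = sp + 1 - t ^+ 2.
Proof.
have -> : \sum_i l i ^+ 2 =
    \sum_i 'X_i ^+ 2 - 2 * t * (\sum_i C (p i) * 'X_i) + t ^+ 2 * \sum_i C (p i) ^+ 2.
  rewrite [2 * t * _]mulr_sumr [t ^+ 2 * _]mulr_sumr -sumrB -big_split.
  by apply: eq_bigr => i _; rewrite /perp_poly/=; ring.
have -> : \sum_i C (p i) ^+ 2 = 1.
  rewrite -[1](rmorph1 C) -Sp rmorph_sum.
  by apply: eq_bigr => i _; rewrite rmorphXn.
by rewrite -/dot_poly /sphere_poly; ring.
Qed.

(* Taylor expansion at [t p] of a form of degree [d], with [x = t p + l]. *)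
Definition taylor_form (d : nat) (g : A) (c : R) (b : 'I_n -> R)
    (a : 'I_n -> 'I_n -> A) :=
  [/\ g = C c * t ^+ d + t ^+ d.-1 * (\sum_i C (b i) * l i) +
          \sum_i \sum_j a i j * (l i * l j),
      d = 0 -> forall i, b i = 0 &
      forall i j x, meval (fun k => - x k) (a i j) = (-1) ^+ d * meval x (a i j)].

Let taylor d g := exists c b a, taylor_form d g c b a.

Let taylor0 d : taylor d 0.
Proof.
exists 0, (fun=> 0), (fun _ _ => 0); split => // [|i j x]; last by rewrite !rmorph0 mulr0.
rewrite rmorph0 mul0r add0r big1 => [|i _]; last by rewrite mul0r.
by rewrite mulr0 add0r big1// => i _; rewrite big1// => j _; rewrite mul0r.
Qed.

Let taylorD d g1 g2 : taylor d g1 -> taylor d g2 -> taylor d (g1 + g2).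
Proof.
move=> [c1 [b1 [a1 [-> h1 e1]]]] [c2 [b2 [a2 [-> h2 e2]]]].
exists (c1 + c2), (fun i => b1 i + b2 i), (fun i j => a1 i j + a2 i j); split.
- have -> : \sum_i C (b1 i + b2 i) * l i =
      \sum_i C (b1 i) * l i + \sum_i C (b2 i) * l i.
    by rewrite -big_split; apply: eq_bigr => i _; rewrite rmorphD/=; ring.
  have -> : \sum_i \sum_j (a1 i j + a2 i j) * (l i * l j) =
      \sum_i \sum_j a1 i j * (l i * l j) + \sum_i \sum_j a2 i j * (l i * l j).
    rewrite -big_split; apply: eq_bigr => i _; rewrite -big_split.
    by apply: eq_bigr => j _ /=; ring.
  by rewrite rmorphD/=; ring.
- by move=> d0 i; rewrite h1// h2// addr0.
- by move=> i j x; rewrite !mevalD e1 e2 mulrDr.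
Qed.

Let taylorZ d e g : taylor d g -> taylor d (C e * g).
Proof.
move=> [c [b [a [-> h1 e1]]]].
exists (e * c), (fun i => e * b i), (fun i j => C e * a i j); split.
- have -> : \sum_i C (e * b i) * l i = C e * \sum_i C (b i) * l i.
    by rewrite mulr_sumr; apply: eq_bigr => i _; rewrite rmorphM/=; ring.
  have -> : \sum_i \sum_j (C e * a i j) * (l i * l j) =
      C e * \sum_i \sum_j a i j * (l i * l j).
    rewrite mulr_sumr; apply: eq_bigr => i _; rewrite mulr_sumr.
    by apply: eq_bigr => j _ /=; ring.
  by rewrite rmorphM/=; ring.
- by move=> d0 i; rewrite h1// mulr0.
- by move=> i j x; rewrite !mevalM e1 !mevalC; ring.
Qed.

(** X_k = p_k t + l_k is substituted in front of the constant and linear terms only; the quadratic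
    term just absorbs the factor X_k. *)
Let taylorX d k g : taylor d g -> taylor d.+1 ('X_k * g).
Proof.
move=> [c [b [a [-> h1 e1]]]].
exists (c * p k), (fun i => p k * b i + c * (i == k)%:R),
  (fun i j => 'X_k * a i j + (i == k)%:R * (C (b j) * t ^+ d.-1)); split => //.
- have Xk : 'X_k = C (p k) * t + l k by rewrite /perp_poly addrC subrK.
  have -> : \sum_i C (p k * b i + c * (i == k)%:R) * l i =
      C (p k) * (\sum_i C (b i) * l i) + C c * l k.
    rewrite mulr_sumr -(sum_delta k (fun i => C c * l i)) -big_split.
    by apply: eq_bigr => i _ /=; rewrite rmorphD !rmorphM/= rmorph_nat; ring.
  have -> : \sum_i \sum_j ('X_k * a i j + (i == k)%:R * (C (b j) * t ^+ d.-1)) * (l i * l j)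
     = 'X_k * (\sum_i \sum_j a i j * (l i * l j)) +
       t ^+ d.-1 * l k * (\sum_j C (b j) * l j).
    rewrite [X in _ = X + _]mulr_sumr [X in _ = _ + X]mulr_sumr.
    have -> : \sum_j t ^+ d.-1 * l k * (C (b j) * l j) =
      \sum_i \sum_j (i == k)%:R * (t ^+ d.-1 * l i * (C (b j) * l j)).
      rewrite -(sum_delta k (fun i => \sum_j t ^+ d.-1 * l i * (C (b j) * l j))).
      by apply: eq_bigr => i _; rewrite mulr_sumr; apply: eq_bigr => j _; ring.
    rewrite -big_split; apply: eq_bigr => i _; rewrite mulr_sumr -big_split.
    by apply: eq_bigr => j _ /=; ring.
  set B := \sum_i C (b i) * l i; set Q := \sum_i \sum_j a i j * _.
  (* For [d = 0] the truncated predecessor spoils the exponent, but then [b] is zero. *)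
  have B0 : t * (t ^+ d.-1 * B) = t ^+ d * B.
    case: d h1 {e1} => [|d] h1 /=; last by rewrite exprS; ring.
    by rewrite /B big1 ?mulr0// => i _; rewrite h1// rmorph0 mul0r.
  rewrite rmorphM exprS /= mulrDr mulrDr {1 2}Xk.
  transitivity (C c * C (p k) * (t * t ^+ d) +
    (C c * t ^+ d * l k + C (p k) * (t * (t ^+ d.-1 * B))) +
    ('X_k * Q + t ^+ d.-1 * l k * B)); first by ring.
  by rewrite B0; ring.
- move=> i j x; rewrite !mevalD !mevalM e1 !mevalC mevalXU rmorph_nat rmorphXn/=.
  have tN : meval (fun k => - x k) t = - meval x t.
    by rewrite !meval_dot_poly -sumrN; apply: eq_bigr => m _; rewrite mulrN.
  rewrite tN rmorphXn/= mevalXU rmorph_nat (exprS _ d).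
  case: d h1 {e1} => [|d] h1 /=; first by rewrite h1//; ring.
  by rewrite (exprNn (meval x t)) exprS; ring.
Qed.

Lemma taylor_dhomog d (f : dhomog n R d) : exists c b a, taylor_form d f c b a.
Proof.
have /dhomogP hf := dhomog_is_dhomog f.
have tX m : taylor (mdeg m) (mpolyX R m).
  rewrite mpolyXE_id mdegE.
  have base : taylor 0 1.
    exists 1, (fun=> 0), (fun _ _ => 0); split => // [|i j x]; last first.
      by rewrite !rmorph0 mulr0.
    rewrite rmorph1 mul1r expr0 big1 => [|i _]; last by rewrite rmorph0 mul0r.
    rewrite mulr0 addr0 big1 ?addr0// => i _.
    by rewrite big1// => j _; rewrite mul0r.
  elim: (index_enum _) => [|i r IH]; first by rewrite !big_nil.
  rewrite !big_cons; elim: (m i) => [|k IHk]; first by rewrite expr0 mul1r.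
  by rewrite exprS -mulrA addSn; exact: taylorX.
rewrite -/(taylor d f) (mpolyE f) big_seq; apply: big_ind => //.
  by move=> g1 g2; exact: taylorD.
move=> m mf; rewrite -mul_mpolyC; apply: taylorZ.
by have := tX m; rewrite hf.
Qed.

End Decomposition.

(** * First- and second-order conditions along great circles *)

Section SecondOrder.
Variables (R : realType) (n : nat).
Local Notation A := {mpoly R[n]}.
Local Notation C := (@mpolyC n R).
Local Notation sp := (@sphere_poly R n).
Local Notation S := (@sphere R n).
Variables (p : 'I_n -> R) (d : nat) (f : dhomog n R d) (kappa : R).
Local Notation t := (dot_poly p).
Local Notation l := (perp_poly p).
Hypothesis Sp : S p.
Hypothesis growth : forall y, S y ->
  kappa * (1 - meval y t ^+ d) <= meval y f - meval p f.
Variables (c : R) (b : 'I_n -> R) (a : 'I_n -> 'I_n -> A).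
Hypothesis f_taylor : taylor_form p d f c b a.

Lemma meval_dot_poly_self : meval p t = 1.
Proof. by rewrite meval_dot_poly -Sp; apply: eq_bigr => i _; rewrite expr2. Qed.

Lemma meval_perp_poly_self i : meval p (l i) = 0.
Proof. by rewrite meval_perp_poly meval_dot_poly_self mulr1 subrr. Qed.

Lemma taylor_const : c = meval p f.
Proof.
have [-> _ _] := f_taylor.
rewrite !mevalD !mevalM mevalC rmorphXn/= meval_dot_poly_self expr1n mulr1.
rewrite rmorph_sum big1 => [|i _]; last by rewrite rmorphM/= meval_perp_poly_self mulr0.
rewrite rmorph_sum big1 ?mulr0 ?addr0// => i _.
rewrite rmorph_sum big1// => j _.
by rewrite !rmorphM/= meval_perp_poly_self mul0r mulr0.
Qed.

(* The rational parametrization of the great circle through [p] in direction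
   [v], cleared of its denominator [1 + s^2 |v|^2]. *)
Definition curve (v : 'I_n -> R) (s : R) i : R :=
  (1 - s ^+ 2 * \sum_j v j ^+ 2) * p i + 2 * s * v i.

Lemma curve_poly v (g : A) : exists P : {poly R}, forall s, meval (curve v s) g = P.[s].
Proof.
move: g; apply: mpoly_ring_ind => [e|i|g1 g2 [P1 E1] [P2 E2]|g1 g2 [P1 E1] [P2 E2]].
- by exists e%:P => s; rewrite mevalC hornerC.
- exists ((1 - (\sum_j v j ^+ 2)%:P * 'X ^+ 2) * (p i)%:P + (2 * v i)%:P * 'X) => s.
  by rewrite mevalXU !hornerE/= /curve; ring.
- by exists (P1 + P2) => s; rewrite mevalD E1 E2 hornerD.
- by exists (P1 * P2) => s; rewrite mevalM E1 E2 hornerM.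
Qed.

Section Direction.
Variable v : 'I_n -> R.
Hypothesis pv : \sum_i p i * v i = 0.
Let w := \sum_j v j ^+ 2.

Let sum_p : \sum_i p i ^+ 2 = 1. Proof. exact: Sp. Qed.

Let curve_dot s : meval (curve v s) t = 1 - s ^+ 2 * w.
Proof.
rewrite meval_dot_poly; transitivity (\sum_i ((1 - s ^+ 2 * w) * p i ^+ 2 +
    2 * s * (p i * v i))).
  by apply: eq_bigr => i _; rewrite /curve -/w; ring.
by rewrite big_split/= -!mulr_sumr pv sum_p mulr1 mulr0 addr0.
Qed.

Let curve_perp s i : meval (curve v s) (l i) = 2 * s * v i.
Proof. by rewrite meval_perp_poly curve_dot /curve -/w; ring. Qed.

Let curve_sphere s : S (fun i => (1 + s ^+ 2 * w)^-1 * curve v s i).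
Proof.
have w0 : 0 <= w by rewrite sumr_ge0// => i _; exact: sqr_ge0.
have D0 : 1 + s ^+ 2 * w != 0 by rewrite gt_eqF// ltr_pwDl// mulr_ge0// sqr_ge0.
rewrite /sphere/=; under eq_bigr => i _ do rewrite exprMn.
rewrite -mulr_sumr; have -> : \sum_i curve v s i ^+ 2 = (1 + s ^+ 2 * w) ^+ 2.
  transitivity (\sum_i ((1 - s ^+ 2 * w) ^+ 2 * p i ^+ 2 +
    4 * s * (1 - s ^+ 2 * w) * (p i * v i) + 4 * s ^+ 2 * v i ^+ 2)).
    by apply: eq_bigr => i _; rewrite /curve -/w; ring.
  by rewrite !big_split/= -!mulr_sumr pv sum_p -/w; ring.
by rewrite -exprMn mulVf// expr1n.
Qed.

(** The growth bound along the curve, multiplied by the d-th power of the denominator, reads 0 <= s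
    F(s) with [F] a polynomial. F(0) is twice the first-order term; when that term vanishes, F = s Q
    and Q(0) is the second-order condition. *)
Lemma second_order_ge0 : 0 <= \sum_i b i * v i /\
  (\sum_i b i * v i = 0 ->
   d%:R / 2 * (meval p f + kappa) * w <=
   \sum_i \sum_j meval p (a i j) * (v i * v j)).
Proof.
have [P PE] := curve_poly v (\sum_i \sum_j a i j * (C (v i) * C (v j))).
pose beta : {poly R} := 1 - w%:P * 'X ^+ 2.
pose D : {poly R} := 1 + w%:P * 'X ^+ 2.
(* The cofactor of D - beta = 2 w s^2 in D^d - beta^d; its value at 0 is d. *)
pose E : {poly R} := \sum_(i < d) D ^+ (d.-1 - i) * beta ^+ i.
pose Q : {poly R} := 4%:P * P - (2 * (meval p f + kappa) * w)%:P * E.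
pose F : {poly R} := (2 * \sum_i b i * v i)%:P * beta ^+ d.-1 + 'X * Q.
have betaE s : beta.[s] = 1 - s ^+ 2 * w by rewrite /beta !hornerE/=; ring.
have DE s : D.[s] = 1 + s ^+ 2 * w by rewrite /D !hornerE/=; ring.
have FQ s : F.[s] = (2 * \sum_i b i * v i) * beta.[s] ^+ d.-1 + s * Q.[s].
  by rewrite /F hornerD !hornerM hornerC horner_exp hornerX.
have QE s : Q.[s] = 4 * P.[s] - (2 * (meval p f + kappa) * w) * E.[s].
  by rewrite /Q hornerD hornerN !hornerM !hornerC.
have FE s : 0 <= s * F.[s].
  have w0 : 0 <= w by rewrite sumr_ge0// => i _; exact: sqr_ge0.
  have D0 : 0 < D.[s] by rewrite DE ltr_pwDl// mulr_ge0// sqr_ge0.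
  have Dd0 : 0 < D.[s] ^+ d by rewrite exprn_gt0.
  have := growth (curve_sphere s).
  rewrite meval_scale meval_dot_poly.
  under eq_bigr => i _ do rewrite mulrCA.
  rewrite -mulr_sumr -meval_dot_poly curve_dot -DE -betaE exprMn exprVn.
  set Dd := D.[s] ^+ d in Dd0 *; set bd := beta.[s] ^+ d.
  rewrite -(ler_pM2l Dd0).
  have -> : Dd * (kappa * (1 - Dd^-1 * bd)) = kappa * (Dd - bd).
    by field; rewrite gt_eqF.
  have -> : Dd * (Dd^-1 * meval (curve v s) f - meval p f) =
      meval (curve v s) f - Dd * meval p f by field; rewrite gt_eqF.
  rewrite {}/Dd {}/bd in Dd0 *.
  have -> : meval (curve v s) f = meval p f * beta.[s] ^+ d +
      beta.[s] ^+ d.-1 * (2 * s * \sum_i b i * v i) + 4 * s ^+ 2 * P.[s].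
    rewrite -PE -taylor_const; have [-> _ _] := f_taylor.
    rewrite !mevalD !mevalM mevalC !rmorphXn/= curve_dot betaE.
    rewrite !rmorph_sum !mulr_sumr; congr (_ + _ + _).
      by apply: eq_bigr => i _; rewrite rmorphM/= mevalC curve_perp; ring.
    apply: eq_bigr => i _; rewrite !rmorph_sum mulr_sumr; apply: eq_bigr => j _.
    by rewrite !rmorphM/= !mevalC !curve_perp; ring.
  move=> H; apply: le_trans (_ : 0 <= meval p f * beta.[s] ^+ d +
    beta.[s] ^+ d.-1 * (2 * s * \sum_i b i * v i) + 4 * s ^+ 2 * P.[s] -
    D.[s] ^+ d * meval p f - kappa * (D.[s] ^+ d - beta.[s] ^+ d)) _.
    by rewrite subr_ge0.
  have DB : D.[s] ^+ d - beta.[s] ^+ d = 2 * s ^+ 2 * w * E.[s].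
    rewrite subrXX horner_sum DE betaE; congr (_ * _); first by ring.
    by apply: eq_bigr => i _; rewrite hornerM !horner_exp betaE DE.
  have -> : D.[s] ^+ d = beta.[s] ^+ d + 2 * s ^+ 2 * w * E.[s] by rewrite -DB addrC subrK.
  rewrite le_eqVlt; apply/orP; left; apply/eqP.
  by rewrite FQ QE; ring.
have F0 : 0 <= F.[0].
  by apply: poly_ge0_at0 => s s0; have := FE s; rewrite pmulr_rge0.
split.
  by move: F0; rewrite FQ betaE expr0n/= mul0r subr0 expr1n; lra.
move=> bv0; have Q0 : 0 <= Q.[0].
  apply: poly_ge0_at0 => s s0; have := FE s.
  by rewrite FQ bv0 mulr0 mul0r add0r !pmulr_rge0.
have E0 : E.[0] = d%:R.
  rewrite /E horner_sum -[d in RHS]card_ord -sumr_const; apply: eq_bigr => i _.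
  by rewrite hornerM !horner_exp DE betaE expr0n/= mul0r subr0 addr0 !expr1n mulr1.
have P0 : P.[0] = \sum_i \sum_j meval p (a i j) * (v i * v j).
  rewrite -PE (@meval_eq _ _ _ p) => [|i]; last by rewrite /curve; ring.
  rewrite rmorph_sum; apply: eq_bigr => i _; rewrite rmorph_sum.
  by apply: eq_bigr => j _; rewrite !rmorphM/= !mevalC.
by move: Q0; rewrite QE E0 P0; lra.
Qed.

End Direction.

(** Only the component [v] of [b] orthogonal to p contributes. The first-order condition in the
    directions [v] and [- v] gives b.v = 0, and b.v is the squared norm of [v]. *)
Lemma taylor_linear_eq0 : \sum_i C (b i) * l i = 0.
Proof.
pose v i := b i - (\sum_j b j * p j) * p i.
have sum_p : \sum_i p i ^+ 2 = 1 by exact: Sp.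
have pv : \sum_i p i * v i = 0.
  transitivity (\sum_i (b i * p i - (\sum_j b j * p j) * p i ^+ 2)).
    by apply: eq_bigr => i _; rewrite /v; ring.
  by rewrite sumrB -mulr_sumr sum_p mulr1 subrr.
have [bv _] := second_order_ge0 pv.
have [|bNv _] := @second_order_ge0 (fun i => - v i).
  by under eq_bigr => i _ do rewrite mulrN; rewrite sumrN pv oppr0.
have vv : \sum_i v i ^+ 2 = 0.
  transitivity (\sum_i (b i * v i - (\sum_j b j * p j) * (p i * v i))).
    by apply: eq_bigr => i _; rewrite expr2 {1}/v; ring.
  rewrite sumrB -mulr_sumr pv mulr0 subr0.
  move: bNv; under eq_bigr => i _ do rewrite mulrN.
  by rewrite sumrN; lra.
have v0 i : v i = 0.
  apply/eqP; rewrite -sqrf_eq0; apply/eqP; move/psumr_eq0P: vv; apply => // j _.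
  exact: sqr_ge0.
transitivity (\sum_i C (v i) * 'X_i).
  transitivity (\sum_i C (b i) * 'X_i - C (\sum_j b j * p j) * t).
    rewrite rmorph_sum mulr_suml -sumrB; apply: eq_bigr => i _.
    by rewrite /perp_poly rmorphM; ring.
  rewrite mulr_sumr -sumrB; apply: eq_bigr => i _.
  by rewrite rmorphB rmorphM/=; ring.
by rewrite big1// => i _; rewrite v0 rmorph0 mul0r.
Qed.

Lemma taylor_hessian_ge v : \sum_i p i * v i = 0 ->
  d%:R / 2 * (meval p f + kappa) * (\sum_i v i ^+ 2) <=
  \sum_i \sum_j meval p (a i j) * (v i * v j).
Proof.
move=> pv; apply: (second_order_ge0 pv).2.
transitivity (meval v (\sum_i C (b i) * l i)); last first.
  by rewrite taylor_linear_eq0 rmorph0.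
rewrite rmorph_sum; apply: eq_bigr => i _.
by rewrite rmorphM/= mevalC meval_perp_poly meval_dot_poly pv mulr0 subr0.
Qed.

End SecondOrder.

Lemma quad_form_comp (R B : comPzRingType) (phi : {rmorphism R -> B}) n
    (M N : 'I_n -> 'I_n -> R) (w : 'I_n -> B) :
  \sum_i \sum_j phi (\sum_k \sum_m M k m * (N k i * N m j)) * (w i * w j) =
  \sum_k \sum_m phi (M k m) * ((\sum_i phi (N k i) * w i) * (\sum_j phi (N m j) * w j)).
Proof.
transitivity (\sum_(u : 'I_n * 'I_n) \sum_(v : 'I_n * 'I_n)
    phi (M v.1 v.2) * ((phi (N v.1 u.1) * w u.1) * (phi (N v.2 u.2) * w u.2))).
  rewrite pair_bigA; apply: eq_bigr => -[i j] _ /=.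
  rewrite -(pair_bigA _ (fun k m => phi (M k m) *
    ((phi (N k i) * w i) * (phi (N m j) * w j))))/= rmorph_sum mulr_suml.
  apply: eq_bigr => k _; rewrite rmorph_sum mulr_suml; apply: eq_bigr => m _.
  by rewrite !rmorphM/=; ring.
rewrite exchange_big [RHS]pair_bigA; apply: eq_bigr => -[k m] _ /=.
rewrite -mulr_sumr mulr_suml; congr (_ * _).
under [RHS]eq_bigr => i _ do rewrite mulr_sumr.
by rewrite pair_bigA.
Qed.

(** * Weighted squares for the form minus its minimum *)

Section Assembly.
Variables (R : realType) (n : nat).
Local Notation A := {mpoly R[n]}.
Local Notation C := (@mpolyC n R).
Local Notation sp := (@sphere_poly R n).
Local Notation S := (@sphere R n).
Variables (p : 'I_n -> R) (d : nat) (f : dhomog n R d) (kappa : R).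
Local Notation t := (dot_poly p).
Local Notation l := (perp_poly p).
Hypothesis Sp : S p.
Hypothesis d_gt0 : (0 < d)%N.
Hypothesis kappa_gt0 : 0 < kappa.
Hypothesis growth : forall y, S y ->
  kappa * (1 - meval y t ^+ d) <= meval y f - meval p f.
Variables (c : R) (b : 'I_n -> R) (a : 'I_n -> 'I_n -> A).
Hypothesis f_taylor : taylor_form p d f c b a.
Let fmin := meval p f.
Let lam := \sum_i l i ^+ 2.

(** These data depend on the parity of [d]. For even [d] both p and -p are minimizers and the
    squares of the [l i] suffice; for odd [d] an extra square, with [l0 = 1 - t], removes -p from
    the common zeros, and [s0] is its weight. *)
Variables (theta l0 h0 s0 : A) (e : R).
Hypothesis one_sub_dot : 1 - t ^+ d = theta * (lam + l0 ^+ 2) + h0 * sp.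
Hypothesis e_gt0 : 0 < e.
Hypothesis one_sub_dot_ge : forall x, S x ->
  e * meval x (lam + l0 ^+ 2) <= 1 - meval x t ^+ d.
Hypothesis s0E : s0 * l0 ^+ 2 = - C fmin * theta * l0 ^+ 2.
Hypothesis at_zeros : forall x, S x -> (forall i, meval x (l i) = 0) ->
  meval x l0 = 0 ->
  [/\ meval x theta = d%:R / 2, 0 < meval x s0 &
      forall i j, meval x (a i j) = meval p (a i j)].

Let X := \sum_i \sum_j a i j * (l i * l j).
Let Y := \sum_i \sum_j C (meval p (a i j)) * (l i * l j).

Lemma perp_dot0 : \sum_i C (p i) * l i = 0.
Proof.
transitivity (t - t * C (\sum_i p i ^+ 2)).
  rewrite rmorph_sum mulr_sumr -sumrB; apply: eq_bigr => i _.
  by rewrite /perp_poly rmorphXn/=; ring.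
by rewrite (Sp : \sum_i p i ^+ 2 = 1) rmorph1 mulr1 subrr.
Qed.

(* The part of the Hessian in excess of [kappa] is positive semidefinite. *)
Lemma hessian_squares : exists cs : seq ('I_n -> R),
  \sum_(u <- cs) (\sum_i C (u i) * l i) ^+ 2 =
  Y - C (d%:R / 2 * (fmin + kappa)) * lam.
Proof.
pose H k m : R := meval p (a k m) - (k == m)%:R * (d%:R / 2 * (fmin + kappa)).
(* Orthogonal projection along p: the Hessian bound holds only in directions orthogonal to p, and
   the vector of the [l i] is fixed by [N]. *)
pose N k i : R := (k == i)%:R - p k * p i.
have Nw (B : comPzRingType) (phi : {rmorphism R -> B}) (w : 'I_n -> B) k :
    \sum_i phi (N k i) * w i = w k - phi (p k) * \sum_i phi (p i) * w i.
  rewrite mulr_sumr -(sum_delta k w) -sumrB; apply: eq_bigr => i _.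
  by rewrite eq_sym rmorphB rmorphM rmorph_nat; ring.
have HE (B : comPzRingType) (phi : {rmorphism R -> B}) (w : 'I_n -> B) :
    \sum_k \sum_m phi (H k m) * (w k * w m) =
    \sum_k \sum_m phi (meval p (a k m)) * (w k * w m) -
    phi (d%:R / 2 * (fmin + kappa)) * \sum_k w k ^+ 2.
  rewrite mulr_sumr -sumrB; apply: eq_bigr => k _.
  rewrite -(sum_delta k (fun m => phi (d%:R / 2 * (fmin + kappa)) * (w k * w m))).
  rewrite -sumrB; apply: eq_bigr => m _.
  by rewrite rmorphB rmorphM rmorph_nat eq_sym; ring.
have [w|cs csE] := @psd_sum_of_squares R n
    (fun i j => \sum_k \sum_m H k m * (N k i * N m j)).
  have /= -> := quad_form_comp (idfun : {rmorphism R -> R}) H N w.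
  pose v k := w k - p k * \sum_i p i * w i.
  have Nv k : \sum_i N k i * w i = v k.
    by have /= := Nw _ (idfun : {rmorphism R -> R}) w k.
  under eq_bigr => k _ do under eq_bigr => m _ do rewrite !Nv.
  have pv : \sum_i p i * v i = 0.
    transitivity (\sum_i p i * w i - (\sum_i p i ^+ 2) * \sum_i p i * w i).
      rewrite mulr_suml -sumrB; apply: eq_bigr => i _; rewrite /v; ring.
    by rewrite (Sp : \sum_i p i ^+ 2 = 1) mul1r subrr.
  have /= -> := HE _ (idfun : {rmorphism R -> R}) v.
  by rewrite subr_ge0; exact: (taylor_hessian_ge Sp growth f_taylor pv).
exists cs; rewrite -csE quad_form_comp.
have Nl k : \sum_i C (N k i) * l i = l k.
  by rewrite Nw perp_dot0 mulr0 subr0.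
under eq_bigr => k _ do under eq_bigr => m _ do rewrite !Nl.
exact: HE.
Qed.

Let n_gt0 : (0 < n)%N.
Proof.
rewrite lt0n; apply/eqP => n0.
have : \sum_i p i ^+ 2 = 1 := Sp.
rewrite big1 => [/eqP|[i ilt] _]; last by exfalso; move: ilt; rewrite n0.
by rewrite eq_sym oner_eq0.
Qed.

(** The squares of all l_i + l_j and l_i - l_j add up to 4 n [lam], so this constant weight on each
    uses up exactly the surplus d kappa / 2 times [lam]. *)
Let kap := kappa * d%:R / (8 * n%:R).

Let kap_gt0 : 0 < kap.
Proof. by rewrite divr_gt0 ?mulr_gt0 ?ltr0n. Qed.

Let four_kap : 4 * n%:R * kap = d%:R / 2 * kappa.
Proof. by rewrite /kap; field; rewrite pnatr_eq0 -lt0n. Qed.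

(** What remains after freezing the coefficients at p; it vanishes at the minimizers, so [C kap]
    plus or minus it is positive there. The factor 1/4 comes from 4 l_i l_j = (l_i + l_j)^2 - (l_i -
    l_j)^2. *)
Let E i j := C 4^-1 * (a i j - C (meval p (a i j)) -
  (i == j)%:R * (C fmin * (theta - C (d%:R / 2)))).

Let plus_terms : seq (A * A) := [seq (C kap + E u.1 u.2, l u.1 + l u.2) |
  u : ('I_n * 'I_n)%type <- index_enum _].
Let minus_terms : seq (A * A) := [seq (C kap - E u.1 u.2, l u.1 - l u.2) |
  u : ('I_n * 'I_n)%type <- index_enum _].

Let sum_pairs : \sum_(k <- plus_terms ++ minus_terms) k.1 * k.2 ^+ 2 =
  C (d%:R / 2 * kappa) * lam + X - Y - C fmin * (theta - C (d%:R / 2)) * lam.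
Proof.
have four : C 4^-1 * 4 = 1 :> A.
  by rewrite -mpolyC_nat -rmorphM mulVf// rmorph1.
rewrite big_cat !big_map /= -big_split/=.
rewrite -(pair_bigA _ (fun i j : 'I_n => (C kap + E i j) * (l i + l j) ^+ 2 +
  (C kap - E i j) * (l i - l j) ^+ 2))/=.
transitivity (\sum_i (\sum_(j < n) 2 * C kap * l i ^+ 2 + 2 * C kap * lam +
  \sum_j a i j * (l i * l j) - \sum_j C (meval p (a i j)) * (l i * l j) -
  C fmin * (theta - C (d%:R / 2)) * l i ^+ 2)).
  apply: eq_bigr => i _; rewrite [2 * C kap * lam]mulr_sumr.
  rewrite -(sum_delta i (fun j => C fmin * (theta - C (d%:R / 2)) * (l i * l j))).
  rewrite -!big_split/= -!sumrB; apply: eq_bigr => j _.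
  rewrite /E eq_sym; set D := (_ - _ - _).
  transitivity (2 * C kap * (l i ^+ 2 + l j ^+ 2) + (C 4^-1 * 4) * D * (l i * l j)).
    by ring.
  by rewrite four /D; ring.
rewrite !sumrB !big_split/= -/X -/Y; congr (_ + _ - _ - _); last first.
  by rewrite mulr_sumr.
under eq_bigr => i _ do rewrite sumr_const card_ord.
rewrite sumr_const card_ord sumrMnl -mulr_sumr -/lam -four_kap.
by rewrite -[Z in Z + _]mulr_natl -[Z in _ + Z = _]mulr_natl !rmorphM/= !mpolyC_nat; ring.
Qed.

Lemma form_sub_min_sos : sphere_cone 0 ((f : A) - C fmin).
Proof.
have [cs csE] := hessian_squares.
pose lin (u : 'I_n -> R) := \sum_i C (u i) * l i.
pose K := [seq (1 : A, lin u) | u <- cs] ++ (plus_terms ++ minus_terms) ++ [:: (s0, l0)].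
have fE : (f : A) - C fmin = \sum_(k <- K) k.1 * k.2 ^+ 2 + (- C fmin * h0) * sp.
  rewrite big_cat big_cat/= sum_pairs big_map big_seq1/= s0E.
  under eq_bigr => u _ do rewrite mul1r.
  rewrite csE; have [-> _ _] := f_taylor.
  rewrite (taylor_const Sp f_taylor) (taylor_linear_eq0 Sp growth f_taylor) mulr0 addr0.
  rewrite -/fmin -/X.
  transitivity (- C fmin * (1 - t ^+ d) + X); first by ring.
  by rewrite one_sub_dot mulrDr !rmorphM rmorphD/=; ring.
pose L := \sum_(k <- K) k.2 ^+ 2.
have LE x : meval x L = (\sum_(u <- cs) meval x (lin u) ^+ 2) +
    4 * n%:R * meval x lam + meval x l0 ^+ 2.
  rewrite /L !big_cat !big_map big_seq1/= !mevalD !rmorph_sum rmorphXn/= -[RHS]addrA.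
  congr (_ + _); first by apply: eq_bigr => u _; rewrite rmorphXn.
  congr (_ + _); rewrite -big_split/=.
  rewrite -(pair_bigA _ (fun i j : 'I_n => meval x ((l i + l j) ^+ 2) +
    meval x ((l i - l j) ^+ 2)))/=.
  transitivity (\sum_i (\sum_(j < n) 2 * meval x (l i) ^+ 2 + 2 * meval x lam)).
    apply: eq_bigr => i _; rewrite [meval x lam]rmorph_sum mulr_sumr -big_split.
    apply: eq_bigr => j _; rewrite !rmorphXn/= (mevalD x (l i)) (mevalB x (l i)).
    by ring.
  rewrite big_split/= sumr_const card_ord.
  under eq_bigr => i _ do rewrite sumr_const card_ord.
  rewrite sumrMnl -mulr_sumr.
  have -> : \sum_i meval x (l i ^+ 2) = meval x lam by rewrite rmorph_sum.
  have -> : \sum_i meval x (l i) ^+ 2 = meval x lam.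
    by rewrite rmorph_sum; apply: eq_bigr => i _; rewrite rmorphXn.
  by rewrite -[Z in Z + _]mulr_natl -[Z in _ + Z = _]mulr_natl; ring.
have lam_ge0 x : 0 <= meval x lam.
  by rewrite rmorph_sum sumr_ge0// => i _; rewrite rmorphXn sqr_ge0.
have cs_ge0 x : 0 <= \sum_(u <- cs) meval x (lin u) ^+ 2.
  by rewrite sumr_ge0// => u _; exact: sqr_ge0.
(* [B] bounds the Hessian squares by a multiple of [lam]; thus [L] is at most a multiple of lam +
   l0^2, which the growth bound controls. *)
pose B : R := \sum_i \sum_j `|meval p (a i j)| + `|d%:R / 2 * (fmin + kappa)|.
have B0 : 0 <= B.
  by rewrite addr_ge0// sumr_ge0// => i _; rewrite sumr_ge0.
have csB x : \sum_(u <- cs) meval x (lin u) ^+ 2 <= B * meval x lam.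
  have := congr1 (meval x) csE; rewrite rmorph_sum/=.
  under eq_bigr => u _ do rewrite rmorphXn/=.
  rewrite -/lin => ->; rewrite rmorphB rmorphM/= mevalC mulrDl lerD//; last first.
    by rewrite -mulNr ler_wpM2r// -normrN ler_norm.
  rewrite rmorph_sum mulr_suml ler_sum// => i _.
  rewrite rmorph_sum mulr_suml ler_sum// => j _.
  rewrite !rmorphM/= mevalC (le_trans (ler_norm _))// normrM ler_wpM2l//.
  have lle k : meval x (l k) ^+ 2 <= meval x lam.
    rewrite rmorph_sum (bigD1 k)//= rmorphXn lerDl sumr_ge0// => m _.
    by rewrite rmorphXn sqr_ge0.
  have := lle i; have := lle j; rewrite ler_norml.
  have := sqr_ge0 (meval x (l i) + meval x (l j)).
  have := sqr_ge0 (meval x (l i) - meval x (l j)).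
  by rewrite sqrrB sqrrD => *; apply/andP; split; lra.
have N0 : 0 < B + 4 * n%:R + 1 by rewrite ltr_pwDr// addr_ge0// mulr_ge0.
have rate0 : 0 < kappa * e / (B + 4 * n%:R + 1) by rewrite divr_gt0// mulr_gt0.
apply: (weighted_squares_sos fE rate0) => [x Sx|x k Sx].
- apply: (@le_trans _ _ (kappa * e * meval x (lam + l0 ^+ 2))); last first.
    rewrite rmorphB/= mevalC; apply: le_trans _ (growth Sx).
    by rewrite -mulrA ler_pM2l// one_sub_dot_ge.
  rewrite mulrAC ler_pdivrMr// -[leRHS]mulrA ler_pM2l ?mulr_gt0//.
  rewrite -/L LE mevalD rmorphXn/=.
  have := csB x; have := sqr_ge0 (meval x l0); have := lam_ge0 x; move: B0.
  have : 0 <= n%:R :> R by [].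
  by nra.
- rewrite -/L LE => L0.
  have l0x : meval x l0 = 0.
    apply/eqP; rewrite -sqrf_eq0 eq_le sqr_ge0 andbT -L0 lerDr addr_ge0//.
    by rewrite !mulr_ge0.
  have lamx : meval x lam = 0.
    have n0 : 0 < 4 * n%:R :> R by rewrite mulr_gt0 ?ltr0n.
    have := sqr_ge0 (meval x l0); have := cs_ge0 x; have := lam_ge0 x.
    move: L0 n0; move: (4 * n%:R) => m; nra.
  have lx i : meval x (l i) = 0.
    move: lamx; rewrite rmorph_sum => /psumr_eq0P H; apply/eqP.
    rewrite -sqrf_eq0 -rmorphXn H//= => j _.
    by rewrite rmorphXn sqr_ge0.
  have [thx s0x ax] := at_zeros Sx lx l0x.
  have Ex i j : meval x (E i j) = 0.
    by rewrite /E !(rmorphM, rmorphB)/= !mevalC ax thx; ring.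
  rewrite !mem_cat => /or3P[/mapP[u _ ->]|/orP[/mapP[u _ ->]|/mapP[u _ ->]]|].
  + by rewrite /= rmorph1.
  + by rewrite /= rmorphD/= Ex addr0 mevalC.
  + by rewrite /= rmorphB/= Ex subr0 mevalC.
  + by rewrite inE => /eqP ->.
Qed.

End Assembly.

(** * Even and odd degree *)

Section ParityCases.
Variables (R : realType) (n : nat).
Local Notation A := {mpoly R[n]}.
Local Notation C := (@mpolyC n R).
Local Notation sp := (@sphere_poly R n).
Local Notation S := (@sphere R n).
Variables (p : 'I_n -> R) (d : nat) (f : dhomog n R d) (kappa : R).
Local Notation t := (dot_poly p).
Local Notation l := (perp_poly p).
Hypothesis Sp : S p.
Hypothesis d_gt0 : (0 < d)%N.
Hypothesis kappa_gt0 : 0 < kappa.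
Hypothesis growth : forall y, S y ->
  kappa * (1 - meval y t ^+ d) <= meval y f - meval p f.
Let lam := \sum_i l i ^+ 2.

Let lamE x : S x -> meval x lam = 1 - meval x t ^+ 2.
Proof.
move=> Sx; rewrite /lam sum_perp_sqr// rmorphB rmorphD/= rmorph1 rmorphXn/=.
by rewrite meval_sphere_poly// add0r.
Qed.

Let dot_sqr_le1 x : S x -> meval x t ^+ 2 <= 1.
Proof.
move=> Sx; rewrite -subr_ge0 -lamE// rmorph_sum sumr_ge0// => i _.
by rewrite rmorphXn sqr_ge0.
Qed.

Let at_perp0 x : S x -> (forall i, meval x (l i) = 0) ->
  meval x t ^+ 2 = 1 /\ forall i, x i = meval x t * p i.
Proof.
move=> Sx lx; split.
  have := lamE Sx; rewrite rmorph_sum big1 => [|i _]; first lra.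
  by rewrite rmorphXn/= lx expr0n.
by move=> i; have := lx i; rewrite meval_perp_poly => /eqP; rewrite subr_eq0 mulrC => /eqP.
Qed.

(** The [l i] vanish on the sphere at p and -p; the coefficients [a i j] agree at both since they
    have the parity of [d]. *)
Lemma form_sos_even : ~~ odd d -> sphere_cone 0 ((f : A) - C (meval p f)).
Proof.
move=> evd; pose m := d./2.
have dm : d = (2 * m)%N by rewrite mul2n /m -[LHS]odd_double_half (negbTE evd).
have m0 : (0 < m)%N by move: d_gt0; rewrite dm muln_gt0.
have [c [b [a taylor]]] := taylor_dhomog p f.
pose theta : A := \sum_(j < m) (t ^+ 2) ^+ j.
apply: (@form_sub_min_sos R n p d f kappa Sp d_gt0 kappa_gt0 growth c b a taylor
  theta 0 (- theta) 1 1) => //.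
- rewrite dm exprM -/lam -[LHS]opprB subrX1 -/theta /lam sum_perp_sqr//; ring.
- move=> x Sx; rewrite expr0n addr0 mul1r -/lam lamE// lerD2l lerN2.
  have u1 := dot_sqr_le1 Sx; have u0 := sqr_ge0 (meval x t).
  rewrite dm exprM; case: (m) m0 => // m' _.
  by rewrite exprS ler_piMr// exprn_ile1.
- by ring.
- move=> x Sx lx _; have [T1 xT] := at_perp0 Sx lx; split.
  + rewrite rmorph_sum; under eq_bigr => j _ do rewrite !rmorphXn/= T1 expr1n.
    by rewrite sumr_const card_ord dm natrM; field.
  + by rewrite rmorph1.
  + move=> i j; have [_ _ aN] := taylor.
    move/eqP: T1; rewrite sqrf_eq1 => /orP[]/eqP T1.
      by apply: meval_eq => k; rewrite xT T1 mul1r.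
    rewrite (@meval_eq _ _ x (fun k => - p k)) => [|k]; last by rewrite xT T1 mulN1r.
    by rewrite aN -signr_odd (negbTE evd) mul1r.
Qed.

(** Growth at -p forces f(p) < 0, which makes the weight - f(p) theta of (1 - t)^2 positive at p. *)
Lemma form_sos_odd : odd d -> sphere_cone 0 ((f : A) - C (meval p f)).
Proof.
move=> oddd.
have fp0 : meval p f < 0.
  have SNp : S (fun i => -1 * p i).
    rewrite /sphere/= -[RHS](Sp : \sum_i p i ^+ 2 = 1).
    by apply: eq_bigr => i _; rewrite mulN1r sqrrN.
  have := growth SNp; rewrite meval_scale -signr_odd oddd /= expr1 mulN1r.
  rewrite meval_dot_poly (_ : \sum_i _ = -1); last first.
    transitivity (- \sum_i p i ^+ 2); last by rewrite (Sp : \sum_i p i ^+ 2 = 1).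
    by rewrite -sumrN; apply: eq_bigr => i _; rewrite mulN1r mulrN expr2.
  by rewrite -signr_odd oddd /= expr1; move: kappa_gt0; lra.
have [c [b [a taylor]]] := taylor_dhomog p f.
pose theta : A := C 2^-1 * \sum_(j < d) t ^+ j.
have two : C 2^-1 * 2 = 1 :> A.
  by rewrite -mpolyC_nat -rmorphM mulVf// rmorph1.
apply: (@form_sub_min_sos R n p d f kappa Sp d_gt0 kappa_gt0 growth c b a taylor
  theta (1 - t) (- theta) (- C (meval p f) * theta) 4^-1) => //.
- rewrite sum_perp_sqr// -[LHS]opprB subrX1 /theta.
  set s := \sum_(i < d) t ^+ i.
  transitivity ((C 2^-1 * 2) * ((1 - t) * s)); last by ring.
  by rewrite two; ring.
- move=> x Sx; rewrite mevalD rmorphXn rmorphB rmorph1/= -/lam lamE//.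
  set T := meval x t; have T1 : T ^+ 2 <= 1 by exact: dot_sqr_le1.
  have /andP[TN1 TP1] : -1 <= T <= 1.
    by rewrite -ler_norml -(expr_le1 (n := 2)) ?real_normK ?num_real.
  have -> : T ^+ d = T * T ^+ d.-1 by rewrite -exprS prednK.
  have Te0 : 0 <= T ^+ d.-1 by rewrite exprn_even_ge0// -oddS prednK.
  have Te1 : T ^+ d.-1 <= 1.
    rewrite -[d.-1]odd_double_half (_ : odd _ = false).
      by rewrite add0n -mul2n exprM exprn_ile1// sqr_ge0.
    by apply/negbTE; rewrite -oddS prednK.
  have -> : 1 - T ^+ 2 + (1 - T) ^+ 2 = 2 - 2 * T by ring.
  (* The claim is (1 - T) / 2 <= 1 - T^d: for T >= 0 because T^d <= T, for T < 0 because T^d <= 0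
     and T >= -1. *)
  have [T0|T0] := leP 0 T.
    have : T * T ^+ d.-1 <= T by rewrite ler_piMr.
    by lra.
  have : T * T ^+ d.-1 <= 0 by rewrite mulr_le0_ge0// ltW.
  by lra.
- move=> x Sx lx; rewrite rmorphB rmorph1/= => /eqP; rewrite subr_eq0 => /eqP T1.
  have [_ xT] := at_perp0 Sx lx.
  have thx : meval x theta = d%:R / 2.
    rewrite rmorphM rmorph_sum/= mevalC.
    under eq_bigr => j _ do rewrite rmorphXn/= -T1 expr1n.
    by rewrite sumr_const card_ord mulrC.
  split => //.
    rewrite rmorphM rmorphN/= mevalC thx mulr_gt0 ?oppr_gt0// divr_gt0 ?ltr0n//.
  by move=> i j; apply: meval_eq => k; rewrite xT -T1 mul1r.
Qed.

Lemma form_sos : sphere_cone 0 ((f : A) - C (meval p f)).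
Proof. by have [|] := boolP (odd d); [exact: form_sos_odd|exact: form_sos_even]. Qed.

End ParityCases.

(** * Generic quadratic growth *)

Section CoefficientSpace.
Variables (R : realType) (n d : nat).
Local Notation A := {mpoly R[n]}.
Local Notation C := (@mpolyC n R).
Local Notation S := (@sphere R n).
Local Notation N := #|{: monom_of_deg n d}|.
Local Notation vec := (N.-tuple (measurableTypeR R)).
Implicit Types (x y p : 'I_n -> R).

Definition monomial (i : 'I_N) x : R := meval x (mpolyX R (val (enum_val i))).

Definition eval_form (u : vec) x : R := \sum_i tnth u i * monomial i x.

Lemma meval_coeff_vector (f : dhomog n R d) x :
  meval x f = eval_form (coeff_vector f) x.
Proof.
have -> : (f : A) = \sum_(i < N) mcoeff (val (enum_val i)) f *:
    mpolyX R (val (enum_val i)).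
  rewrite -(big_enum_val (A := {: monom_of_deg n d})
    (fun u => mcoeff (val u) f *: mpolyX R (val u)))/=.
  apply/mpolyP => m; rewrite raddf_sum/=.
  under eq_bigr => u _ do rewrite mcoeffZ mcoeffX.
  have /dhomogP hf := dhomog_is_dhomog f.
  have [md|md] := eqVneq (mdeg m) d.
    have mlt : (mdeg m < d.+1)%N by rewrite md.
    pose u : monom_of_deg n d := exist _ (BMultinom mlt) (introT eqP md).
    rewrite (bigD1 u)//= eqxx mulr1 big1 ?addr0// => v vu.
    rewrite (_ : _ == _ = false) ?mulr0//; apply: contra_neqF vu => /eqP vm.
    by apply/val_inj/val_inj.
  rewrite big1 => [|u _].
    by apply: memN_msupp_eq0; apply: contra md => /hf /eqP.
  rewrite (_ : _ == _ = false) ?mulr0//; apply: contra_neqF md => /eqP <-.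
  exact/eqP/(valP u).
rewrite rmorph_sum; apply: eq_bigr => i _ /=.
by rewrite mevalZ tnth_mktuple.
Qed.

Lemma sphere_coord_le1 x j : S x -> `|x j| <= 1.
Proof.
move=> Sx; rewrite -(expr_le1 (n := 2))// real_normK ?num_real//.
rewrite -(Sx : \sum_i x i ^+ 2 = 1) (bigD1 j)//= lerDl sumr_ge0// => i _.
exact: sqr_ge0.
Qed.

Lemma monomial_le1 i x : S x -> `|monomial i x| <= 1.
Proof.
move=> Sx; rewrite /monomial mevalX normr_prod.
suff /andP[] : 0 <= \prod_(j < n) `|x j ^+ (val (enum_val i) : mpoly.multinom n) j| <= 1.
  by [].
apply: (big_ind (fun r : R => 0 <= r <= 1)) => [|r s /andP[? ?] /andP[? ?]|j _].
- by rewrite ler01 lexx.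
- by rewrite mulr_ge0// mulr_ile1.
- by rewrite normrX exprn_ge0//= exprn_ile1// sphere_coord_le1.
Qed.

(** Minus the minimum on the sphere: the sign makes it convex, as a supremum of linear functions of
    [u]. *)
Definition max_neg (u : vec) : R := sup [set - eval_form u x | x in S].

Lemma eval_form_sub u v x : S x ->
  eval_form u x - eval_form v x <= \sum_i `|tnth u i - tnth v i|.
Proof.
move=> Sx; rewrite -sumrB ler_sum// => i _; rewrite -mulrBl.
rewrite (le_trans (ler_norm _))// normrM ler_piMr//; exact: monomial_le1.
Qed.

Lemma eval_form_set_coord (u : vec) i r x :
  eval_form (set_coord u i r) x = eval_form u x + (r - tnth u i) * monomial i x.
Proof.
rewrite /eval_form (bigD1 i)//= [X in _ = X + _](bigD1 i)//= tnth_set_coord eqxx.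
rewrite (eq_bigr (fun j => tnth u j * monomial j x)); first by ring.
by move=> j /negbTE ji; rewrite tnth_set_coord ji.
Qed.

Variable x0 : 'I_n -> R.
Hypothesis Sx0 : S x0.

Lemma max_neg_le u z : (forall x, S x -> - eval_form u x <= z) -> max_neg u <= z.
Proof.
move=> H; apply: ge_sup => [|_ [x Sx <-]]; last exact: H.
by exists (- eval_form u x0), x0.
Qed.

Lemma le_max_neg u x : S x -> - eval_form u x <= max_neg u.
Proof.
move=> Sx; apply: ub_le_sup; last by exists x.
exists (\sum_i `|tnth u i|) => _ [y Sy <-].
rewrite -sumrN ler_sum// => i _.
rewrite (le_trans (ler_norm _))// normrN normrM ler_piMr//; exact: monomial_le1.
Qed.

Lemma max_neg_lipschitz u v : `|max_neg u - max_neg v| <= \sum_i `|tnth u i - tnth v i|.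
Proof.
have aux u' v' : max_neg u' <= max_neg v' + \sum_i `|tnth v' i - tnth u' i|.
  apply: max_neg_le => x Sx.
  have := le_max_neg v' Sx; have := eval_form_sub v' u' Sx; lra.
have := aux u v; have := aux v u.
under [in X in _ -> X -> _]eq_bigr => i _ do rewrite distrC.
by rewrite ler_norml => *; apply/andP; split; lra.
Qed.

Lemma max_neg_convex u i r1 r2 r3 : r1 < r2 -> r2 < r3 ->
  slope (fun r => max_neg (set_coord u i r)) r1 r2 <=
  slope (fun r => max_neg (set_coord u i r)) r2 r3.
Proof.
move=> r12 r23; rewrite /slope ler_pdivrMr ?subr_gt0// mulrAC ler_pdivlMr ?subr_gt0//.
set g1 := max_neg (set_coord u i r1); set g3 := max_neg (set_coord u i r3).
set g2 := max_neg _.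
have r13 : 0 < r3 - r1 by lra.
have : g2 <= (g1 * (r3 - r2) + g3 * (r2 - r1)) / (r3 - r1).
  apply: max_neg_le => x Sx; rewrite ler_pdivlMr//.
  have := le_max_neg (set_coord u i r1) Sx; have := le_max_neg (set_coord u i r3) Sx.
  rewrite -/g1 -/g3 !eval_form_set_coord; nra.
by rewrite ler_pdivlMr//; nra.
Qed.

Lemma max_neg_slope u i r1 r2 r3 r4 : r1 < r2 -> r2 <= r3 -> r3 < r4 ->
  slope (fun r => max_neg (set_coord u i r)) r1 r2 <=
  slope (fun r => max_neg (set_coord u i r)) r3 r4.
Proof.
move=> r12; rewrite le_eqVlt => /predU1P[<-|r23] r34; first exact: max_neg_convex.
by apply: le_trans (max_neg_convex _ _ r23 r34); exact: max_neg_convex.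
Qed.

(** Jensen's inequality: u + h is the mean of the N points that move only coordinate i of [u], by N
    h_i. It carries bounds along the axes to all directions. *)
Lemma max_neg_shift u (h : 'I_N -> R) : (0 < N)%N ->
  max_neg [tuple tnth u i + h i | i < N] <=
  N%:R^-1 * \sum_i max_neg (add_coord u i (N%:R * h i)).
Proof.
move=> N0; have N0' : 0 < N%:R :> R by rewrite ltr0n.
apply: max_neg_le => x Sx; rewrite mulrC ler_pdivlMr//.
have -> : - eval_form [tuple tnth u i + h i | i < N] x * N%:R =
    \sum_i (- eval_form u x - N%:R * h i * monomial i x).
  rewrite sumrB sumr_const card_ord -[Z in _ = Z - _]mulr_natl mulrC.
  transitivity (N%:R * (- eval_form u x - \sum_i h i * monomial i x)).
    rewrite -opprD; congr (_ * - _); rewrite /eval_form -big_split; apply: eq_bigr => i _ /=.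
    by rewrite tnth_mktuple mulrDl.
  rewrite mulrBr mulr_sumr; congr (_ - _).
  by apply: eq_bigr => i _; rewrite mulrA.
apply: ler_sum => i _; apply: le_trans (le_max_neg _ Sx).
rewrite eval_form_set_coord; lra.
Qed.

Lemma monomial_of_map (phi : {ffun 'I_d -> 'I_n}) :
  exists i, forall x, monomial i x = \prod_(j < d) x (phi j).
Proof.
pose m : mpoly.multinom n := \big[@mnm_add n/@mnm0 n]_(j < d) mnm1 (phi j).
have md : mdeg m = d.
  rewrite /m mdeg_sum; under eq_bigr => j _ do rewrite mdeg1.
  by rewrite sum1_card card_ord.
have mlt : (mdeg m < d.+1)%N by rewrite md.
pose u : monom_of_deg n d := exist _ (BMultinom mlt) (introT eqP md).
exists (enum_rank u) => x; rewrite /monomial enum_rankK /= /m.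
by rewrite -mprodXE rmorph_prod; apply: eq_bigr => j _ /=; rewrite mevalXU.
Qed.

Lemma sum_maps (z : 'I_n -> R) :
  \sum_(phi : {ffun 'I_d -> 'I_n}) \prod_j z (phi j) = (\sum_i z i) ^+ d.
Proof.
rewrite -(bigA_distr_bigA (fun (_ : 'I_d) i => z i)).
by rewrite prodr_const card_ord.
Qed.

(* The left-hand side is the squared distance of the d-th tensor powers of [p] and
   [y]. *)
Lemma monomial_dist p y : S p -> S y ->
  2 * (1 - (\sum_i p i * y i) ^+ d) <=
  #|{ffun 'I_d -> 'I_n}|%:R * \sum_i (monomial i p - monomial i y) ^+ 2.
Proof.
move=> Sp Sy.
have -> : 2 * (1 - (\sum_i p i * y i) ^+ d) =
    \sum_(phi : {ffun 'I_d -> 'I_n}) (\prod_j p (phi j) - \prod_j y (phi j)) ^+ 2.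
  transitivity ((\sum_i p i ^+ 2) ^+ d - 2 * (\sum_i p i * y i) ^+ d +
    (\sum_i y i ^+ 2) ^+ d).
    rewrite (Sp : \sum_i p i ^+ 2 = 1) (Sy : \sum_i y i ^+ 2 = 1) expr1n; ring.
  rewrite -!sum_maps mulr_sumr -sumrB -big_split; apply: eq_bigr => phi _ /=.
  by rewrite !prodrXl [Z in 2 * Z]big_split/=; ring.
(* Every tensor entry is a monomial, so each squared difference is one term of the sum over
   monomials. *)
rewrite mulr_natl -sumr_const; apply: ler_sum => phi _.
have [i iE] := monomial_of_map phi.
rewrite -!iE (bigD1 i)//= lerDl sumr_ge0// => j _; exact: sqr_ge0.
Qed.

(** [max_neg] lies above the linear function given by y at u + h and, by the second differences, at
    most quadratically above the one given by p. With h = s (mon p - mon y), comparing the two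
    bounds f(y) - f(p) below by s D - N K1 s^2 D. *)
Lemma growth_at_min u K p : (0 < N)%N -> 0 < K ->
  (forall i s, 0 < s -> s <= 1 ->
    max_neg (add_coord u i s) + max_neg (add_coord u i (- s)) - 2 * max_neg u
      <= K * s ^+ 2) ->
  S p -> (forall x, S x -> eval_form u p <= eval_form u x) ->
  exists2 kappa, 0 < kappa & forall y, S y ->
    kappa * (1 - (\sum_i p i * y i) ^+ d) <= eval_form u y - eval_form u p.
Proof.
move=> N0 K0 Ku Sp pmin.
have Gp : max_neg u = - eval_form u p.
  apply/eqP; rewrite eq_le le_max_neg// andbT max_neg_le// => x Sx.
  by rewrite lerN2 pmin.
pose K1 := K + 1.
(* The point p bounds [max_neg] from below at the opposite shift, and the second difference turns
   this into an upper bound. *)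
have upper i s : `|s| <= 1 ->
    max_neg (add_coord u i s) <= max_neg u - s * monomial i p + K1 * s ^+ 2.
  move=> s1; have low := le_max_neg (add_coord u i (- s)) Sp.
  rewrite eval_form_set_coord in low.
  have {}low : max_neg u + s * monomial i p <= max_neg (add_coord u i (- s)).
    by rewrite Gp; lra.
  have sq : K * s ^+ 2 <= K1 * s ^+ 2 by rewrite ler_wpM2r ?sqr_ge0// lerDl.
  have [s0|s0|s0] := ltgtP 0 s.
  - have := Ku i s s0; rewrite (le_trans (ler_norm _) s1) => /(_ isT); lra.
  - have := Ku i (- s); rewrite oppr_gt0 s0 opprK sqrrN.
    rewrite (le_trans (ler_norm _)) ?normrN// => /(_ isT isT); lra.
  - rewrite -s0 mul0r expr0n mulr0 subr0 addr0.
    by rewrite /add_coord addr0 set_coord_id.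
set M := #|{ffun 'I_d -> 'I_n}|%:R : R.
have M1 : 0 < M + 1 by rewrite ltr_pwDr.
have NR : 1 <= N%:R :> R by rewrite ler1n.
have NK : 0 < 2 * N%:R * K1 by rewrite !mulr_gt0 ?ltr0n// addr_gt0.
exists (2 / (2 * (2 * N%:R * K1) * (M + 1))).
  by rewrite divr_gt0// !mulr_gt0// ?ltr0n// addr_gt0.
move=> y Sy.
pose D := \sum_i (monomial i p - monomial i y) ^+ 2.
have D0 : 0 <= D by rewrite sumr_ge0// => i _; exact: sqr_ge0.
have dist : 2 * (1 - (\sum_i p i * y i) ^+ d) <= (M + 1) * D.
  by apply: le_trans (monomial_dist Sp Sy) _; rewrite ler_wpM2r// lerDl.
suff main : D / (2 * (2 * N%:R * K1)) <= eval_form u y - eval_form u p.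
  apply: le_trans main; rewrite ler_pdivlMr; last by rewrite mulr_gt0.
  rewrite (_ : _ * _ * _ = 2 * (1 - (\sum_i p i * y i) ^+ d) / (M + 1)).
    by rewrite ler_pdivrMr// [leRHS]mulrC.
  move: (_ ^+ d) (2 * N%:R * K1) NK => q r r0.
  by field; rewrite !gt_eqF.
(* The maximizer of s D - N K1 s^2 D; K1 >= 1 keeps the axis shifts N h_i within [-1, 1]. *)
pose s := (2 * N%:R * K1)^-1.
have s0 : 0 < s by rewrite invr_gt0.
pose h i := s * (monomial i p - monomial i y).
have hle i : `|N%:R * h i| <= 1.
  have diff : `|monomial i p - monomial i y| <= 2.
    rewrite (le_trans (ler_normB _ _))// (_ : 2 = 1 + 1 :> R)//.
    by rewrite lerD ?monomial_le1.
  rewrite /h normrM normrM (gtr0_norm s0) ger0_norm//.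
  apply: (@le_trans _ _ (N%:R * (s * 2))).
    by rewrite ler_wpM2l// ler_pM2l.
  rewrite (_ : _ * _ = K1^-1); last first.
    by rewrite /s; field; rewrite !gt_eqF ?ltr0n// addr_gt0.
  by rewrite invf_le1 ?addr_gt0// lerDr ltW.
have := max_neg_shift u h N0.
have := le_max_neg [tuple tnth u i + h i | i < N] Sy.
have -> : eval_form [tuple tnth u i + h i | i < N] y =
    eval_form u y + \sum_i h i * monomial i y.
  by rewrite /eval_form -big_split; apply: eq_bigr => i _; rewrite tnth_mktuple/= mulrDl.
have : N%:R^-1 * \sum_i max_neg (add_coord u i (N%:R * h i)) <=
    max_neg u - \sum_i h i * monomial i p + K1 * N%:R * \sum_i h i ^+ 2.
  rewrite mulrC ler_pdivrMr; last by rewrite ltr0n.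
  apply: (@le_trans _ _ (\sum_i (max_neg u - N%:R * h i * monomial i p +
    K1 * (N%:R * h i) ^+ 2))).
    by apply: ler_sum => i _; exact: upper.
  rewrite big_split sumrB sumr_const card_ord/= mulrDl mulrBl [Z in _ <= Z - _ + _]mulr_natr.
  rewrite le_eqVlt; apply/orP; left; apply/eqP; congr (_ - _ + _).
    by rewrite mulr_suml; apply: eq_bigr => i _; ring.
  by rewrite mulr_sumr mulr_suml; apply: eq_bigr => i _; ring.
have -> : \sum_i h i * monomial i p = \sum_i h i * monomial i y + s * D.
  by rewrite mulr_sumr -big_split; apply: eq_bigr => i _; rewrite /h/=; ring.
have -> : \sum_i h i ^+ 2 = s ^+ 2 * D.
  by rewrite mulr_sumr; apply: eq_bigr => i _; rewrite /h/=; ring.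
rewrite Gp.
have -> : D / (2 * (2 * N%:R * K1)) = s * D - K1 * N%:R * (s ^+ 2 * D).
  by rewrite /s; field; rewrite !gt_eqF//= ?ltr0n// addr_gt0.
lra.
Qed.

End CoefficientSpace.

(** * From a certificate to finite convergence *)

Section Certificate.
Variables (R : realType) (n : nat).
Local Notation A := {mpoly R[n]}.
Local Notation C := (@mpolyC n R).
Local Notation S := (@sphere R n).

Lemma finite_convergence_of_certificate d (f : A) p : S p ->
  (forall x, S x -> meval p f <= meval x f) ->
  sphere_cone 0 (f - C (meval p f)) -> lasserre_finite_convergence d f.
Proof.
move=> Sp pmin [s [s' [h [ss _]]]]; rewrite mulr0 addr0 => fE.
(* Large enough for both degrees and for d; the 2 absorbs the subtraction in 2 k - 2. *)
pose k := (d + mmeasure mdeg s + mmeasure mdeg h + 2)%N.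
exists k; split; first by rewrite /k geq_max; apply/andP; split; lia.
exists (meval p f).
  by split; [exists p|move=> _ [x Sx <-]; exact: pmin].
apply/eqP; rewrite eq_le; apply/andP; split.
  apply: ge_ereal_sup => _ [gamma [s1 [h1 [ss1 _ _ E]]] <-].
  rewrite lee_fin -subr_ge0.
  have := congr1 (meval p) E.
  rewrite mevalB mevalD mevalM mevalC meval_sphere_poly// mulr0 addr0 => ->.
  exact: is_sos_ge0.
apply: ereal_sup_ubound; exists (meval p f) => //.
by exists s, h; split => //; rewrite /k; lia.
Qed.

Lemma sphere_nonempty : (0 < n)%N -> S !=set0.
Proof.
move=> n0; exists (fun i => (i == Ordinal n0)%:R); rewrite /sphere/=.
transitivity (\sum_i (i == Ordinal n0)%:R * (1 : R)); last exact: sum_delta.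
by apply: eq_bigr => i _; case: (i == _); rewrite ?mulr1 ?expr1n ?expr0n.
Qed.

End Certificate.

Theorem corollary3p5 (R : realType) (n d : nat)
    (hn : (1 <= n)%N) (hd : (1 <= d)%N) :
  generic (fun f : dhomog n R d => lasserre_finite_convergence d f).
Proof.
have [x0 Sx0] := sphere_nonempty R hn.
have N0 : (0 < #|{: monom_of_deg n d}|)%N.
  have [i _] := monomial_of_map R [ffun _ : 'I_d => Ordinal hn].
  exact: leq_ltn_trans (leq0n i) (ltn_ord i).
have [B [mB B0 HB]] := ae_second_diff
  (@max_neg_slope R n d x0 Sx0) (@max_neg_lipschitz R n d x0 Sx0).
(* Negligibility needs only a measurable null set containing the coefficient vectors of the
   exceptional forms. *)
exists B; split => // _ [f Nf <-]; apply: contrapT => /HB[K K0 HK].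
apply: Nf.
have [p Sp pmin] := sphere_min f Sx0.
have [|kappa k0 growth] := growth_at_min Sx0 N0 K0 HK Sp.
  by move=> x Sx; rewrite -!meval_coeff_vector; exact: pmin.
apply: (@finite_convergence_of_certificate R n d f p Sp pmin).
apply: (form_sos Sp hd k0) => y Sy.
by rewrite meval_dot_poly !meval_coeff_vector; exact: growth.
Qed.
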